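(* Fix integers $a,b\ge0$, and let $w=a+b+1$. The limiting density of a nonempty retention rule $U\subseteq\mathcal A^w$ is $$D(U)=\frac{2\sum_{u\le v,\ u,v\in U}m_{uv}}{\sum_{u\in U}\mu_u}.$$ Its maximum over all nonempty $U\subseteq\mathcal A^w$ is the optimum of the linear program in real variables $x_u$ ($u\in\mathcal A^w$), $z_{uv}$ ($u<v$ in $\mathcal A^w$): $$\text{maximize }\ 2\sum_{u<v}m_{uv}z_{uv}+2\sum_u m_{uu}x_u$$ $$\text{subject to }\ 0\le z_{uv}\le x_u,\quad z_{uv}\le x_v,\quad x_u\ge0,\quad \sum_u\mu_ux_u=1.$$ All coefficients $m_{uv},\mu_u$ and the optimum belong to the field $K=\mathbb Q(\sqrt3,\sqrt{2\sqrt3-1})$. An upper bound $d$ for the densities $D(U)$ has a certificate consisting of real allocations $A_{uv}$, $u<v$, satisfying $$0\le A_{uv}\le 2m_{uv}\quad(u<v),\qquad 2m_{uu}+\sum_{v>u}A_{uv}+\sum_{v<u}(2m_{vu}-A_{vu})\le d\,\mu_u\quad\text{for every }u\in\mathcal A^w,$$ that is, the existence of such an allocation implies $D(U)\le d$ for every nonempty $U$, and every upper bound $d$ admits such an allocation. When $d$ is the optimum, such an allocation exists with all $A_{uv}\in K$.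
   Context: A (rooted ordered binary) tree is either the one-leaf tree $E$ or an ordered pair $(T_0,T_1)$ of trees. The height is $\mathrm{ht}(E)=0$, $\mathrm{ht}((T_0,T_1))=1+\max(\mathrm{ht}(T_0),\mathrm{ht}(T_1))$. A marked forest $v(\mathcal F,i)$ is a finite nonempty sequence $\mathcal F=(T_1,\dots,T_m)$ of trees together with a marked position $i\in\{1,\dots,m\}$. $\mathrm{BB}(n,k)$ is the set of marked forests with $n$ leaves in total and all tree heights at most $k$. It is regarded as an undirected graph with the following edges: (horizontal) $v(\mathcal F,i)$ is adjacent to $v(\mathcal F,i+1)$; (vertical) if $T_i=(A,B)$, then $v(\mathcal F,i)$ is adjacent to $v(\mathcal F',i)$, where $\mathcal F'$ is obtained from $\mathcal F$ by replacing the entry $T_i$ by the two consecutive entries $A,B$ (a split, with the marker at the left child $A$; the inverse operation is a merge, allowed when the merged tree has height at most $k$). For a nonempty set $Y$ of vertices, $\operatorname{dens}(Y)=2|E(Y)|/|Y|$, where $E(Y)$ is the set of edges with both endpoints in $Y$. For $k\ge3$, the category of a tree $T$ of height at most $k$ is $\mathrm E$ if $T=E$, $\mathrm H$ if $\mathrm{ht}(T)=k$, and $\mathrm L$ if $1\le\mathrm{ht}(T)\le k-1$. Put $\mathcal A=\{\mathrm E,\mathrm L,\mathrm H\}$. Retention rules. The type of $v(\mathcal F,i)$ is the word of $w$ categories of the trees $T_{i-a},\dots,T_{i+b}$. (Markers too close to a forest end may be treated by any convention; this has no effect on the limits.) A retention rule is a nonempty set $U\subseteq\mathcal A^w$: one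 retains precisely the vertices whose type is in $U$. Its limiting density is $D(U)=\lim_{k\to\infty}\lim_{n\to\infty}\operatorname{dens}(Y_{n,k}(U))$, where $Y_{n,k}(U)\subseteq\mathrm{BB}(n,k)$ is the set of retained vertices. Weights. Put $e=\frac14$, $h=1-\frac{\sqrt3}2$, $\ell=\frac{\sqrt3}2-\frac14$, and $p_{\mathrm E}=e$, $p_{\mathrm L}=\ell$, $p_{\mathrm H}=h$. For a word $c_1\cdots c_r$ over $\mathcal A$, let $\mathrm{wt}(c_1\cdots c_r)=\prod_i p_{c_i}$ (equal to $1$ for the empty word). For $v\in\mathcal A^w$ let $\mu_v=\mathrm{wt}(v)$. Put $u_1=\sqrt3/2$, $u_2=\sqrt{2\sqrt3-1}/2$, and define vectors indexed by $(\mathrm E,\mathrm L,\mathrm H)$: $v_1=(e,u_1-e,0)$, $v_2=(e,u_2-e,0)$. For $t,i,j\in\mathcal A$ define $$\kappa_{\mathrm E ij}=0,\qquad \kappa_{\mathrm L ij}=(v_2)_i(v_2)_j,\qquad \kappa_{\mathrm H ij}=(v_1)_i(v_1)_j-(v_2)_i(v_2)_j.$$ Weighted graph of types. For a word $W$ of length at least $r$ let $\mathrm{pref}_r(W)$ be its first $r$ letters. Form a weighted undirected graph on vertex set $\mathcal A^w$, with loops allowed, as follows. For each $z\in\mathcal A^{w+1}$, put weight $\mathrm{wt}(z)$ between the first $w$ letters of $z$ and the last $w$ letters of $z$. For each $A\in\mathcal A^a$, $B\in\mathcal A^b$ and $t,i,j\in\mathcal A$, put weight $\mathrm{wt}(AB)\kappa_{tij}$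 between $AtB$ and $A\,\mathrm{pref}_{b+1}(ijB)$. Fix a total order on $\mathcal A^w$; for $u\le v$, $m_{uv}$ is the sum of all weights put between the unordered pair of types $\{u,v\}$ (a loop if $u=v$). *)

(* Defs.v *)
From HB Require Import structures.
From mathcomp Require Import all_boot all_order all_algebra finmap.
From mathcomp Require Import all_classical all_reals all_analysis.
Set Implicit Arguments.
Unset Strict Implicit.
Unset Printing Implicit Defensive.
Import Order.TTheory GRing.Theory Num.Theory.
Import numFieldNormedType.Exports.
Local Open Scope ring_scope.

Inductive tree := Leaf | Node of tree & tree.

Fixpoint tree_encode (t : tree) : GenTree.tree unit :=
  if t is Node A B then GenTree.Node 0 [:: tree_encode A; tree_encode B]
  else GenTree.Leaf tt.

Fixpoint tree_decode (t : GenTree.tree unit) : tree :=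
  if t is GenTree.Node _ [:: A; B] then Node (tree_decode A) (tree_decode B)
  else Leaf.

Lemma tree_encodeK : cancel tree_encode tree_decode.
Proof. by elim=> //= A -> B ->. Qed.

HB.instance Definition _ := Countable.copy tree (can_type tree_encodeK).

Fixpoint height (t : tree) : nat :=
  if t is Node A B then (maxn (height A) (height B)).+1 else 0%N.

Fixpoint leaves (t : tree) : nat :=
  if t is Node A B then (leaves A + leaves B)%N else 1%N.

(* A sequence of trees with a marked position, numbered from 0; the position
   is in range for the members of BB below, which also makes the sequence
   nonempty. *)
Notation mforest := (seq tree * nat)%type.

Definition in_BB (n k : nat) (v : mforest) : bool :=
  [&& (v.2 < size v.1)%N, sumn (map leaves v.1) == n
    & all (fun t => (height t <= k)%N) v.1].

(* fset_set is meaningful only on finite sets; see finite_BB and mem_BB. *)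
Definition BB (n k : nat) : {fset mforest} :=
  fset_set [set v : mforest | in_BB n k v]%classic.

Definition horizontal (v v' : mforest) : bool :=
  (v'.1 == v.1) && (v'.2 == v.2.+1).

Definition splits (v v' : mforest) : bool :=
  if nth Leaf v.1 v.2 is Node A B then
    v' == (take v.2 v.1 ++ [:: A; B] ++ drop v.2.+1 v.1, v.2)
  else false.

Definition adj (v v' : mforest) : bool :=
  [|| horizontal v v', horizontal v' v, splits v v' | splits v' v].

(* Edges are unordered pairs of vertices. *)
Definition edges (Y : {fset mforest}) : {fset {fset mforest}} :=
  [fset [fset x; y]%fset | x in Y, y in Y & adj x y]%fset.

Definition dens (R : realType) (Y : {fset mforest}) : R :=
  2 * (#|` edges Y|)%:R / (#|` Y|)%:R.

Inductive category := catE | catL | catH.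

Definition category_code (c : category) : 'I_3 :=
  match c with catE => inord 0 | catL => inord 1 | catH => inord 2 end.

Definition category_decode (i : 'I_3) : category :=
  match val i with 0 => catE | 1 => catL | _ => catH end.

Lemma category_codeK : cancel category_code category_decode.
Proof. by case; rewrite /category_decode /= inordK. Qed.

HB.instance Definition _ := Finite.copy category (can_type category_codeK).

Definition category_of (k : nat) (t : tree) : category :=
  if t is Leaf then catE else if height t == k then catH else catL.

Notation word w := (w.-tuple category).

Notation width a b := (a + b).+1.

Definition has_window (a b : nat) (v : mforest) : bool :=
  (a <= v.2)%N && (v.2 + b < size v.1)%N.

Definition type_of (a b k : nat) (v : mforest) : word (width a b) :=
  [tuple category_of k (nth Leaf v.1 (v.2 - a + j)) | j < width a b].

(* Which vertices are retained among those whose marker is too close to a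
   forest end: an arbitrary choice, for each rule U and each n and k. *)
Definition convention (a b : nat) : Type :=
  {set word (width a b)} -> nat -> nat -> pred mforest.

Definition retained (a b : nat) (conv : convention a b)
    (U : {set word (width a b)}) (n k : nat) : {fset mforest} :=
  [fset v in BB n k |
    if has_window a b v then type_of a b k v \in U else conv U n k v]%fset.

(* The inner limit (n to infinity, k fixed) and the iterated limit; lim is
   total, so existence of the limits has to be asserted separately. *)
Definition density_at (R : realType) (a b : nat) (conv : convention a b)
    (U : {set word (width a b)}) (k : nat) : R :=
  limn (fun n => dens R (retained conv U n k)).

Definition D (R : realType) (a b : nat) (conv : convention a b)
    (U : {set word (width a b)}) : R :=
  limn (fun k => density_at R conv U k).

Definition D_exists (R : realType) (a b : nat) (conv : convention a b)
    (U : {set word (width a b)}) : Prop :=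
  (forall k, (3 <= k)%N -> cvgn (fun n => dens R (retained conv U n k))) /\
  cvgn (fun k => density_at R conv U k).

Definition pcat (R : realType) (c : category) : R :=
  match c with
  | catE => 1 / 4
  | catL => Num.sqrt 3 / 2 - 1 / 4
  | catH => 1 - Num.sqrt 3 / 2
  end.

Definition wt (R : realType) (s : seq category) : R := \prod_(c <- s) pcat R c.

Definition mu (R : realType) (w : nat) (v : word w) : R := wt R v.

Definition u1 (R : realType) : R := Num.sqrt 3 / 2.
Definition u2 (R : realType) : R := Num.sqrt (2 * Num.sqrt 3 - 1) / 2.

Definition v1 (R : realType) (c : category) : R :=
  match c with catE => pcat R catE | catL => u1 R - pcat R catE | catH => 0 end.
Definition v2 (R : realType) (c : category) : R :=
  match c with catE => pcat R catE | catL => u2 R - pcat R catE | catH => 0 end.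

Definition kappa (R : realType) (t i j : category) : R :=
  match t with
  | catE => 0
  | catL => v2 R i * v2 R j
  | catH => v1 R i * v1 R j - v2 R i * v2 R j
  end.

(* {x, y} = {u, v} as unordered pairs. *)
Definition same_pair (x y u v : seq category) : bool :=
  ((x == u) && (y == v)) || ((x == v) && (y == u)).

Definition mweight (R : realType) (a b : nat) (u v : word (width a b)) : R :=
  \sum_(z : word (width a b).+1
          | same_pair (take (width a b) z) (drop 1 z) u v) wt R z
  + \sum_(A : word a) \sum_(B : word b)
      \sum_(t : category) \sum_(i : category) \sum_(j : category
          | same_pair (A ++ t :: B) (A ++ take b.+1 (i :: j :: B)) u v)
        wt R (A ++ B) * kappa R t i j.

Definition strict (T : eqType) (le : rel T) (x y : T) : bool :=
  (x != y) && le x y.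

Definition total_order (T : eqType) (le : rel T) : Prop :=
  [/\ reflexive le, antisymmetric le, transitive le & total le].

Definition density_formula (R : realType) (a b : nat)
    (le : rel (word (width a b))) (U : {set word (width a b)}) : R :=
  2 * (\sum_(u in U) \sum_(v in U | le u v) mweight R u v) / \sum_(u in U) mu R u.

(* The linear program: z u v is a variable only for u < v. *)
Definition lp_feasible (R : realType) (a b : nat)
    (le : rel (word (width a b)))
    (x : word (width a b) -> R)
    (z : word (width a b) -> word (width a b) -> R) : Prop :=
  [/\ forall u v, strict le u v ->
        [/\ 0 <= z u v, z u v <= x u & z u v <= x v],
      forall u, 0 <= x u
    & \sum_u mu R u * x u = 1].

Definition lp_objective (R : realType) (a b : nat)
    (le : rel (word (width a b)))
    (x : word (width a b) -> R)
    (z : word (width a b) -> word (width a b) -> R) : R :=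
  2 * (\sum_u \sum_(v | strict le u v) mweight R u v * z u v)
  + 2 * \sum_u mweight R u u * x u.

Definition lp_optimum (R : realType) (a b : nat)
    (le : rel (word (width a b))) (opt : R) : Prop :=
  (exists x z, lp_feasible le x z /\ lp_objective le x z = opt) /\
  (forall x z, lp_feasible le x z -> lp_objective le x z <= opt).

Definition max_density (R : realType) (a b : nat) (conv : convention a b)
    (d : R) : Prop :=
  (exists2 U : {set word (width a b)}, U != finset.set0 & D R conv U = d) /\
  (forall U : {set word (width a b)}, U != finset.set0 -> D R conv U <= d).

Definition certificate (R : realType) (a b : nat)
    (le : rel (word (width a b))) (d : R)
    (A : word (width a b) -> word (width a b) -> R) : Prop :=
  (forall u v, strict le u v -> 0 <= A u v <= 2 * mweight R u v) /\
  (forall u,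
     2 * mweight R u u + \sum_(v | strict le u v) A u v
       + \sum_(v | strict le v u) (2 * mweight R v u - A v u) <= d * mu R u).

(* x lies in the smallest subfield of R containing both generators. *)
Definition in_K (R : realType) (x : R) : Prop :=
  forall S : {pred R}, divring_closed S ->
    Num.sqrt 3 \in S -> Num.sqrt (2 * Num.sqrt 3 - 1) \in S -> x \in S.

Fixpoint trees_upto (k : nat) : seq tree :=
  if k is k'.+1 then
    Leaf :: [seq Node A B | A <- trees_upto k', B <- trees_upto k']
  else [:: Leaf].

Lemma mem_trees_upto k t : (height t <= k)%N -> t \in trees_upto k.
Proof.
elim: k t => [|k IH] [|A B] //=.
rewrite ltnS geq_max => /andP[hA hB].
by rewrite inE; apply/orP; right; apply: allpairs_f; apply: IH.
Qed.

Fixpoint seqs_upto (s : seq tree) (n : nat) : seq (seq tree) :=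
  if n is n'.+1 then
    [::] :: [seq t :: F | t <- s, F <- seqs_upto s n']
  else [:: [::]].

Lemma mem_seqs_upto (s : seq tree) n (F : seq tree) :
  (size F <= n)%N -> {subset F <= s} -> F \in seqs_upto s n.
Proof.
elim: n F => [|n IH] [|t F] //=.
rewrite ltnS => hF sF; rewrite inE; apply/orP; right.
apply: allpairs_f; first by apply: sF; rewrite mem_head.
by apply: IH => // x xF; apply: sF; rewrite inE xF orbT.
Qed.

Lemma leaves_gt0 t : (0 < leaves t)%N.
Proof. by elim: t => //= A hA B hB; rewrite addn_gt0 hA. Qed.

Lemma size_le_leaves (F : seq tree) : (size F <= sumn (map leaves F))%N.
Proof.
by elim: F => //= t F IH; rewrite -add1n leq_add // leaves_gt0.
Qed.

Lemma finite_BB n k : finite_set [set v : mforest | in_BB n k v]%classic.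
Proof.
pose s := [seq (F, i) | F <- seqs_upto (trees_upto k) n, i <- iota 0 n].
apply: (@sub_finite_set _ _ [set` s]%classic); last exact: finite_seq.
move=> [F i] /= /and3P[/= hi /eqP hn /allP hk].
have hF : (size F <= n)%N by rewrite -hn size_le_leaves.
apply: allpairs_f.
  by apply: mem_seqs_upto => // t /hk; apply: mem_trees_upto.
by rewrite mem_iota add0n (leq_trans hi hF).
Qed.

Lemma mem_BB n k v : (v \in BB n k) = in_BB n k v.
Proof.
rewrite /BB in_fset_set; last exact: finite_BB.
by apply/idP/idP; rewrite inE.
Qed.

Lemma edgesP (Y : {fset mforest}) (e : {fset mforest}) :
  e \in edges Y <->
  exists x y, [/\ x \in Y, y \in Y, adj x y & e = [fset x; y]%fset].
Proof.
split.
  move=> /imfset2P[x /= hx [y]].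
  by rewrite !inE /= => /andP[hy ad] ->; exists x, y.
move=> [x [y [hx hy ad ->]]]; apply/imfset2P; exists x; first by [].
by exists y => //; rewrite !inE /= hy.
Qed.

(* Main.v *)
Require Import Defs.
From mathcomp Require Import all_boot all_order all_algebra finmap.
From mathcomp Require Import all_classical all_reals all_analysis.
From mathcomp Require Import ring lra zify.
Set Implicit Arguments.
Unset Strict Implicit.
Unset Printing Implicit Defensive.
Import Order.TTheory GRing.Theory Num.Theory.
Import numFieldNormedType.Exports.
Local Open Scope classical_set_scope.
Local Open Scope ring_scope.

(** Fix the height bound k and let T_k(x) be the polynomial that counts the
    trees of height at most k by their leaves, so that T_0 = x and
    T_(k+1) = x + T_k ^ 2. Let r be the positive root of T_k(r) = 1. Giving a
    tree the weight r ^ leaves makes the trees of height at most k a probability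
    distribution, and the number of forests with n leaves, times r ^ n, becomes
    a renewal sequence for it. The one-leaf tree is a step of length one, so
    this sequence converges to some L > 0 (renewal_theorem).

    A marked forest whose marker is far from both ends is a triple (forest,
    window, forest). The number of those with n leaves and a given window W is
    therefore a convolution square, equivalent to
    L ^ 2 * n * r ^ leaves(W) / r ^ n, whereas only O(1 / r ^ n) markers are
    close to an end, whatever is done with them (windowed_cvg). Each edge is a
    marker shift or a split in exactly one way (card_edges), and the window
    determines whether its two ends are retained. Hence, divided by
    L ^ 2 * n / r ^ n, both |E(Y)| and |Y| tend to finite sums over windows,
    and these factor over the letters of the types (dens_cvg_type_density).

    When k grows, r tends to 1/4: on [0, 1/4] one has T_k <= 1/2, while
    T_k(x) >= k (x - 1/4) for x >= 0. The recurrence gives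
    T_(k-1)(r) = sqrt (1 - r) and T_(k-2)(r) = sqrt (T_(k-1)(r) - r), whose
    limits are the numbers u_1 and u_2; the weights of categories and of splits
    are polynomials in these three quantities (D_type_density).

    For the linear program, an allocation distributes the weight 2 m_uv of each
    edge between its two ends without loading any type beyond d mu_u. A
    counting argument over a set U, which is weak duality at the point
    1_U / mu(U), shows that an allocation forces D(U) <= d. Conversely, if every
    set satisfies the bound then the edges can be treated one after the other:
    supermodularity of the weight inside a set leaves room for each of them
    (fractional_orientation). The shares chosen are minima of sums and
    differences of the data, hence stay in K. So the best U, the linear program
    and the smallest certified bound have the same value. *)

(** * Renewal sequences and their convolution squares *)

Section Renewal.
Variables (R : realType) (I : eqType) (ts : seq I) (p : I -> R) (s : I -> nat).
Variables (N : nat) (i0 : I) (u : nat -> R).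
Hypothesis p_ge0 : forall i, 0 <= p i.
Hypothesis p_sum : \sum_(i <- ts) p i = 1.
Hypothesis s_gt0 : forall i, (0 < s i)%N.
Hypothesis s_le : {in ts, forall i, (s i <= N)%N}.
Hypothesis i0_ts : i0 \in ts.
Hypothesis s_i0 : s i0 = 1%N.
Hypothesis p_i0 : 0 < p i0.
Hypothesis u0 : u 0%N = 1.
Hypothesis uE : forall n, (0 < n)%N ->
  u n = \sum_(i <- ts | (s i <= n)%N) p i * u (n - s i)%N.

Lemma renewal_ge0 n : 0 <= u n.
Proof.
elim/ltn_ind: n => -[|n] IH; first by rewrite u0 ler01.
by rewrite uE // sumr_ge0 // => i si; rewrite mulr_ge0 // IH // ltn_subrL s_gt0.
Qed.

Lemma renewal_gt0 n : 0 < u n.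
Proof.
elim: n => [|n IH]; first by rewrite u0 ltr01.
rewrite uE // (big_rem i0) //= s_i0 ltr_pwDl //.
  by rewrite mulr_gt0 // subn1.
by rewrite sumr_ge0 // => i si; rewrite mulr_ge0 // renewal_ge0.
Qed.

Lemma renewal_step_bound : (0 < N)%N.
Proof. by rewrite -s_i0 s_le. Qed.

Lemma renewal_recurrence n : (N <= n)%N -> u n = \sum_(i <- ts) p i * u (n - s i)%N.
Proof.
move=> Nn; rewrite uE; last exact: leq_trans renewal_step_bound _.
rewrite big_seq_cond [RHS]big_seq; apply: eq_bigl => i.
by case: (boolP (i \in ts)) => //= /s_le iN; rewrite (leq_trans iN).
Qed.

Definition window_min n := \big[Num.min/u n]_(i < N) u (n + i)%N.
Definition window_max n := \big[Num.max/0]_(i < N) u (n + i)%N.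

Lemma window_min_le n j : (n <= j < n + N)%N -> window_min n <= u j.
Proof.
move=> /andP[nj jN]; have jn : (j - n < N)%N by rewrite ltn_subLR.
apply: (bigmin_inf (Ordinal jn)) => //=.
by rewrite subnKC.
Qed.

Lemma le_window_max n j : (n <= j < n + N)%N -> u j <= window_max n.
Proof.
move=> /andP[nj jN]; have jn : (j - n < N)%N by rewrite ltn_subLR.
apply: (bigmax_sup (Ordinal jn)) => //=.
by rewrite subnKC.
Qed.

(** Beyond the window each term is a weighted mean of the N preceding ones, so
    bounds on a window persist forever. *)
Lemma window_min_le_tail n j : (n <= j)%N -> window_min n <= u j.
Proof.
elim/ltn_ind: j => j IH nj.
have [jN|Nj] := ltnP j (n + N)%N; first by rewrite window_min_le // nj.
rewrite renewal_recurrence; last by lia.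
rewrite -[window_min n]mul1r -p_sum mulr_suml.
rewrite big_seq [leRHS]big_seq; apply: ler_sum => i its.
have := s_le its; have := s_gt0 i => ? ?.
by rewrite ler_wpM2l // IH //; lia.
Qed.

Lemma tail_le_window_max n j : (n <= j)%N -> u j <= window_max n.
Proof.
elim/ltn_ind: j => j IH nj.
have [jN|Nj] := ltnP j (n + N)%N; first by rewrite le_window_max // nj.
rewrite renewal_recurrence; last by lia.
rewrite -[window_max n]mul1r -p_sum mulr_suml.
rewrite big_seq [leRHS]big_seq; apply: ler_sum => i its.
have := s_le its; have := s_gt0 i => ? ?.
by rewrite ler_wpM2l // IH //; lia.
Qed.

Lemma le_window_min n c : (forall j, (n <= j)%N -> c <= u j) -> c <= window_min n.
Proof. by move=> H; apply: le_bigmin => [|i _]; apply: H; rewrite ?leq_addr. Qed.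

Lemma window_max_attained n : exists2 j, (n <= j < n + N)%N & u j = window_max n.
Proof.
have [//|i _|i _ /esym ui] := @eq_bigmax _ _ _ 0 (Ordinal renewal_step_bound)
    predT (fun i => u (n + i)%N).
  exact: renewal_ge0.
by exists (n + i)%N => //; rewrite leq_addr ltn_add2l ltn_ord.
Qed.

Lemma unit_step_le1 : p i0 <= 1.
Proof. by rewrite -p_sum (big_rem i0) //= lerDl sumr_ge0. Qed.

(** A unit step keeps at least the fraction [p i0] of the excess of a term over
    an earlier window minimum, since the other terms of the mean are not below
    that minimum. *)
Lemma renewal_contract n k j : (n + N <= j)%N ->
  p i0 ^+ k * (u j - window_min n) <= u (j + k)%N - window_min n.
Proof.
move=> nj; elim: k => [|k IH]; first by rewrite addn0 expr0 mul1r.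
rewrite addnS [u (j + k).+1]renewal_recurrence; last by lia.
rewrite exprS -mulrA.
have <- : \sum_(i <- ts) p i * (u ((j + k).+1 - s i)%N - window_min n)
       = \sum_(i <- ts) p i * u ((j + k).+1 - s i)%N - window_min n.
  under eq_bigr do rewrite mulrBr.
  by rewrite sumrB -mulr_suml p_sum mul1r.
rewrite (big_rem i0) //= s_i0 subn1 /=.
apply: le_trans (_ : p i0 * (u (j + k)%N - window_min n) <= _); first by rewrite ler_wpM2l.
rewrite lerDl big_seq sumr_ge0 // => i /mem_rem its.
rewrite mulr_ge0 // subr_ge0 window_min_le_tail //.
by have := s_le its; lia.
Qed.

(** The maximum of the window at n + N is passed on, by at most 2N unit steps,
    to every position of the window at n + 2N. *)
Lemma window_min_gain n :
  p i0 ^+ (2 * N)%N * (window_max (n + N) - window_min n) <= window_min (n + 2 * N) - window_min n.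
Proof.
have [j /andP[j1 j2] <-] := window_max_attained (n + N).
have uj : 0 <= u j - window_min n by rewrite subr_ge0 window_min_le_tail //; lia.
rewrite lerBrDr; apply: le_bigmin => [|i _]; rewrite -lerBrDr.
  rewrite -[(n + 2 * N)%N](subnKC (_ : j <= _)%N); last by lia.
  apply: le_trans (renewal_contract _ _) => //.
  by rewrite ler_wpM2r // ler_wiXn2l ?unit_step_le1 ?ltW //; lia.
rewrite -[(n + 2 * N + i)%N](subnKC (_ : j <= _)%N); last by lia.
apply: le_trans (renewal_contract _ _) => //.
by rewrite ler_wpM2r // ler_wiXn2l ?unit_step_le1 ?ltW //; have := ltn_ord i; lia.
Qed.

Lemma window_min_nondecreasing : nondecreasing_seq window_min.
Proof. by move=> m n mn; apply: le_window_min => j nj; apply: window_min_le_tail; lia. Qed.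

(** The window minima increase and converge; their increments dominate a fixed
    fraction of the gap between maximum and minimum, which therefore vanishes.
    The limit is positive because the first minimum already is. *)
Lemma renewal_theorem : exists2 L : R, 0 < L & u @ \oo --> L.
Proof.
have cvlo : cvgn window_min.
  apply: nondecreasing_is_cvgn; first exact: window_min_nondecreasing.
  exists (window_max 0) => _ [n _ <-].
  exact: le_trans (window_min_le_tail (leqnn n)) (tail_le_window_max (leq0n n)).
have lo0 : 0 < window_min 0.
  rewrite /window_min; elim/big_ind: _ => [|x y x0 y0|i _]; try exact: renewal_gt0.
  by rewrite lt_min x0.
exists (limn window_min).
  exact: lt_le_trans lo0 (nondecreasing_cvgn_le window_min_nondecreasing cvlo 0%N).
have cv2 : window_min (n + 2 * N)%N @[n --> \oo] --> limn window_min by rewrite cvg_shiftn.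
pose q := p i0 ^+ (2 * N)%N.
have q0 : 0 < q by rewrite exprn_gt0.
have up : (window_min n + q^-1 * (window_min (n + 2 * N)%N - window_min n))
    @[n --> \oo] --> limn window_min.
  rewrite -[X in _ --> X]addr0 -(mulr0 q^-1) -(subrr (limn window_min)).
  by apply: cvgD => //; apply: cvgMl_tmp; apply: cvgB.
rewrite -(cvg_shiftn N); apply: squeeze_cvgr cvlo up.
near=> n; rewrite /= window_min_le_tail ?leq_addr //=.
rewrite -lerBlDl ler_pdivlMl //.
apply: le_trans (window_min_gain n); rewrite ler_wpM2l ?(ltW q0) //.
by rewrite lerB // tail_le_window_max.
Unshelve. all: by end_near.
Qed.

End Renewal.

Section Convolution.
Variables (R : realType) (u : nat -> R) (L : R).
Hypothesis cvu : u @ \oo --> L.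

Definition autoconv (n : nat) : R := \sum_(j < n.+1) u j * u (n - j)%N.

(** Writing u_j u_(n-j) - L^2 as u_(n-j) (u_j - L) + L (u_(n-j) - L) bounds the
    error by a multiple of the Cesaro mean of |u_j - L|. *)
Lemma autoconv_cesaro : autoconv n / n.+1%:R @[n --> \oo] --> L ^+ 2.
Proof.
have [C uC] : exists C, forall n, `|u n| <= C.
  have /cvg_seq_bounded := cvgP _ cvu.
  rewrite /bounded_near /= => -[M [Mr HM]].
  exists (M + 1) => n; apply: (HM (M + 1)) => //.
  by rewrite ltrDl ltr01.
have cva : (fun n => `|u n - L|) @ \oo --> (0 : R).
  rewrite -(normr0 R) -(subrr L); apply: cvg_norm; apply: cvgB => //.
  exact: cvg_cst.
have := cesaro cva => cvces.
apply/cvgrPdist_le => e e0.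
pose K := C + `|L|.
have cvK : K * arithmetic_mean (fun n => `|u n - L|) n @[n --> \oo] --> 0.
  by rewrite -[X in _ --> X](mulr0 K); apply: cvgMl_tmp.
have /cvgrPdist_le/(_ e e0) := cvK.
apply: filterS => n; rewrite sub0r normrN.
move=> H; apply: le_trans H; apply: le_trans (ler_norm _).
rewrite /arithmetic_mean /= /series /= big_mkord.
have -> : L ^+ 2 - autoconv n / n.+1%:R =
    n.+1%:R^-1 * \sum_(j < n.+1) (L * L - u j * u (n - j)%N).
  rewrite sumrB sumr_const card_ord -/(autoconv n) -[(L * L) *+ _]mulr_natl.
  have : n.+1%:R != 0 :> R by rewrite pnatr_eq0.
  by move: (n.+1%:R : R) => x x0; field.
rewrite normrM ger0_norm ?invr_ge0 ?ler0n // [leRHS]mulrCA.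
rewrite ler_wpM2l ?invr_ge0 ?ler0n // (le_trans (ler_norm_sum _ _ _)) //.
have rev : \sum_(j < n.+1) `|u j - L| = \sum_(j < n.+1) `|u (n - j)%N - L|.
  by rewrite (reindex_inj rev_ord_inj); apply: eq_bigr => j _; rewrite /= subSS.
rewrite /K mulrDl {2}rev !mulr_sumr -big_split /=; apply: ler_sum => j _.
have -> : L * L - u j * u (n - j)%N =
   - (u (n - j)%N * (u j - L) + L * (u (n - j)%N - L)) by ring.
rewrite normrN; apply: le_trans (ler_normD _ _) _.
by rewrite !normrM lerD // ler_wpM2r.
Qed.

Lemma autoconv_shift (s : nat) : autoconv (n - s) / n.+1%:R @[n --> \oo] --> L ^+ 2.
Proof.
rewrite -(cvg_shiftn s).
have cv1 : (n.+1%:R / (n + s).+1%:R : R) @[n --> \oo] --> (1 : R).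
  have : (1 - s%:R * ((n + s).+1%:R)^-1 : R) @[n --> \oo] --> (1 - s%:R * 0 : R).
    apply: cvgB; first exact: cvg_cst.
    apply: cvgMl_tmp.
    by have := @cvg_harmonic R; rewrite -(cvg_shiftn s).
  rewrite mulr0 subr0; apply: cvg_trans; apply: near_eq_cvg; near=> n.
  have : (n + s).+1%:R != 0 :> R by rewrite pnatr_eq0.
  rewrite -addSn natrD; move: (n.+1%:R : R) (s%:R : R) => x y H; field.
  exact: H.
rewrite -[L ^+ 2]mulr1.
apply: cvg_trans (cvgM autoconv_cesaro cv1).
apply: near_eq_cvg; near=> n; rewrite /= addnK mulrA mulfVK //.
Unshelve. all: by end_near.
Qed.

Lemma vanish_bounded (c : nat -> R) (C : R) :
  (forall n, 0 <= c n <= C * u n) -> c n / n.+1%:R @[n --> \oo] --> (0 : R).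
Proof.
move=> H.
have cv0 : (C * u n * harmonic n) @[n --> \oo] --> (C * L * 0).
  by apply: cvgM cvg_harmonic; apply: cvgMl_tmp.
rewrite mulr0 in cv0.
apply: (squeeze_cvgr _ (cvg_cst 0) cv0); near=> n.
have /andP[c0 c1] := H n.
by rewrite divr_ge0 //= ler_pM2r // invr_gt0.
Unshelve. all: by end_near.
Qed.
End Convolution.

(** * Counting marked forests by the window around the marker *)

Definition nleaves (F : seq tree) : nat := sumn (map leaves F).
Definition heights_le (k : nat) (F : seq tree) : bool := all (fun t => height t <= k)%N F.

Lemma nleaves_cat F G : nleaves (F ++ G) = (nleaves F + nleaves G)%N.
Proof. by rewrite /nleaves map_cat sumn_cat. Qed.

Lemma mem_trees_uptoE k t : (t \in trees_upto k) = (height t <= k)%N.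
Proof.
apply/idP/idP; last exact: mem_trees_upto.
elim: k t => [|k IH] t; first by rewrite inE => /eqP ->.
rewrite inE => /orP[/eqP -> //|/allpairsP[[A B] /= [/IH hA /IH hB ->]]] /=.
by rewrite ltnS geq_max hA.
Qed.

Lemma trees_upto_uniq k : uniq (trees_upto k).
Proof.
elim: k => //= k IH; rewrite allpairs_uniq // ?andbT.
  by apply/negP => /allpairsP[[A B] /= []].
by move=> [A B] [C D] _ _ [-> ->].
Qed.

(** Every tree has a leaf, so n trees suffice for n leaves. *)
Definition forests k n : seq (seq tree) :=
  [seq F <- undup (seqs_upto (trees_upto k) n) | heights_le k F && (nleaves F == n)].

Lemma forests_uniq k n : uniq (forests k n).
Proof. by rewrite filter_uniq // undup_uniq. Qed.

Lemma mem_forests k n F : (F \in forests k n) = heights_le k F && (nleaves F == n).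
Proof.
rewrite mem_filter mem_undup; apply: andb_idr => /andP[/allP lF /eqP <-].
apply: mem_seqs_upto; first exact: size_le_leaves.
by move=> t /lF; rewrite mem_trees_uptoE.
Qed.

Definition nforests k n := size (forests k n).

Lemma nforests0 k : nforests k 0 = 1%N.
Proof.
suff /perm_size : perm_eq (forests k 0) [:: [::]] by [].
apply: uniq_perm; rewrite ?forests_uniq // => -[|t F]; rewrite mem_forests !inE //=.
Qed.

Lemma nforestsS k n : (0 < n)%N ->
  nforests k n = (\sum_(t <- trees_upto k | leaves t <= n) nforests k (n - leaves t))%N.
Proof.
move=> n0; rewrite -big_filter.
pose s := [seq t :: F | t <- [seq t <- trees_upto k | leaves t <= n],
                        F <- forests k (n - leaves t)]%N.
have /perm_size : perm_eq (forests k n) s.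
  apply: uniq_perm; first exact: forests_uniq.
    apply: allpairs_uniq_dep; first by rewrite filter_uniq // trees_upto_uniq.
      by move=> *; apply: forests_uniq.
    by move=> [t F] [t' F'] _ _ [-> ->].
  move=> F; rewrite mem_forests; apply/idP/allpairsPdep.
    case: F => [|t F]; first by rewrite /nleaves /= eq_sym (gtn_eqF n0).
    move=> /= /andP[/andP[ht lF] /eqP tF].
    exists t, F; split=> //; first by rewrite mem_filter mem_trees_uptoE ht -tF leq_addr.
    by rewrite mem_forests lF -tF /nleaves /= addKn eqxx.
  move=> [t [G []]]; rewrite mem_filter mem_trees_uptoE => /andP[tn ht].
  rewrite mem_forests => /andP[lG /eqP tG] ->.
  by rewrite /= ht lG /nleaves /= -/(nleaves G) tG subnKC // eqxx.
by rewrite /nforests => ->; rewrite size_allpairs_dep sumnE big_map.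
Qed.

Definition forest_pairs k n : seq (seq tree * seq tree) :=
  [seq p | j <- iota 0 n.+1,
           p <- [seq (F, G) | F <- forests k j, G <- forests k (n - j)]]%N.

Lemma mem_forest_pairs k n p :
  (p \in forest_pairs k n) =
  [&& heights_le k p.1, heights_le k p.2 & nleaves p.1 + nleaves p.2 == n]%N.
Proof.
apply/allpairsPdep/idP.
  move=> [j [_ [+ /allpairsP[[F G] /= [+ + ->] ->]]]] /=.
  rewrite mem_iota !mem_forests /= => jn /andP[-> /eqP ->] /andP[-> /eqP ->] /=.
  by rewrite subnKC.
case: p => F G /and3P[lF lG /eqP tF]; rewrite /= in lF lG tF; rewrite -tF.
exists (nleaves F), (F, G); split=> //; first by rewrite mem_iota ltnS leq_addr.
by rewrite allpairs_f // mem_forests ?lF ?lG ?addKn eqxx.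
Qed.

Lemma forest_pairs_uniq k n : uniq (forest_pairs k n).
Proof.
apply: allpairs_uniq_dep; first exact: iota_uniq.
  move=> j _; apply: allpairs_uniq; try exact: forests_uniq.
  by move=> [F G] [F' G'].
move=> [j p] [j' p'] /allpairsPdep[x [y [_ + e]]] /allpairsPdep[x' [y' [_ + e']]] /=.
case: e e' => -> -> [-> ->].
move=> /allpairsP[[F G] /= [+ _ ->]] /allpairsP[[F' G'] /= [+ _ ->]].
rewrite !mem_forests => /andP[_ /eqP <-] /andP[_ /eqP <-] [-> ->] //.
Qed.

Lemma size_forest_pairs k n :
  size (forest_pairs k n) = (\sum_(j < n.+1) nforests k j * nforests k (n - j))%N.
Proof.
rewrite size_allpairs_dep sumnE big_map 
  -(big_mkord predT (fun j => nforests k j * nforests k (n - j))%N).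
by rewrite /index_iota subn0; apply: eq_bigr => j _; rewrite size_allpairs.
Qed.

Fixpoint windows k w : seq (seq tree) :=
  if w is w'.+1 then [seq t :: W | t <- trees_upto k, W <- windows k w']
  else [:: [::]].

Lemma windows_uniq k w : uniq (windows k w).
Proof.
elim: w => //= w IH; apply: allpairs_uniq => //; first exact: trees_upto_uniq.
by move=> [t F] [t' F'] _ _ [-> ->].
Qed.

Lemma mem_windows k w W : (W \in windows k w) = (size W == w) && heights_le k W.
Proof.
elim: w W => [|w IH] W; first by rewrite inE; case: W.
apply/allpairsP/idP.
  move=> [[t F] /= []]; rewrite IH mem_trees_uptoE => ht /andP[/eqP <- lF] -> /=.
  by rewrite ht lF eqxx.
case: W => // t F /= /andP[/eqP[sF] /andP[ht lF]].
by exists (t, F); rewrite IH mem_trees_uptoE ht sF eqxx lF.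
Qed.

Definition window (a b : nat) (v : mforest) : seq tree :=
  take (width a b) (drop (v.2 - a) v.1).

Lemma heights_le_cat k F G : heights_le k (F ++ G) = heights_le k F && heights_le k G.
Proof. exact: all_cat. Qed.

(** Such a marked forest is cut into its left part, its window and its right
    part; the position of the marker is recovered from the size of the left
    part. *)
Lemma count_windowed (a b k n : nat) (Q : pred (seq tree)) :
  count (fun v => has_window a b v && Q (window a b v)) (BB n k) =
  (\sum_(W <- windows k (width a b) | Q W && (nleaves W <= n))
      size (forest_pairs k (n - nleaves W)))%N.
Proof.
rewrite -size_filter -big_filter.
pose s := [seq (p.1 ++ W ++ p.2, size p.1 + a)%N
  | W <- [seq W <- windows k (width a b) | Q W && (nleaves W <= n)%N],
    p <- forest_pairs k (n - nleaves W)].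
set r := [seq v <- _ | _].
have /perm_size -> : perm_eq r s.
  apply: uniq_perm; first by rewrite filter_uniq // fset_uniq.
    apply: allpairs_uniq_dep; first by rewrite filter_uniq // windows_uniq.
      by move=> *; apply: forest_pairs_uniq.
    move=> [W [F G]] [W' [F' G']] /allpairsPdep[x [y [+ _ e]]] /allpairsPdep[x' [y' [+ _ e']]] /=.
    case: e e' => -> _ [-> _] {y y'}; rewrite !mem_filter !mem_windows.
    move=> /andP[_ /andP[/eqP sx _]] /andP[_ /andP[/eqP sx' _]] [] /[swap] /addIn sF.
    move/eqP; rewrite eqseq_cat // => /andP[/eqP -> ].
    by rewrite eqseq_cat ?sx ?sx' // => /andP[/eqP -> /eqP ->].
  move=> [F i]; rewrite mem_filter mem_BB /in_BB /has_window /=.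
  apply/idP/allpairsPdep.
    move=> /andP[/andP[/andP[ai ib] QW] /and3P[iF /eqP tF lF]].
    exists (window a b (F, i)), (take (i - a) F, drop (i + b.+1) F).
    have eF : F = take (i - a) F ++ window a b (F, i) ++ drop (i + b.+1) F.
      rewrite /window /= -[in LHS](cat_take_drop (i - a) F); congr (_ ++ _).
      rewrite -[in LHS](cat_take_drop (width a b) (drop (i - a) F)); congr (_ ++ _).
      by rewrite drop_drop; congr (drop _ _); lia.
    move: lF tF; rewrite -/(heights_le k F) -/(nleaves F) {1 2}eF !heights_le_cat
      !nleaves_cat => /and3P[l1 l2 l3] tF.
    split; last 1 first.
    - by rewrite -eF size_take; congr (_, _); case: ifP; lia.
    - rewrite mem_filter QW mem_windows l2 size_take size_drop /=.
      by rewrite andbT -tF addnCA leq_addr /=; case: ifP; lia.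
    - by rewrite mem_forest_pairs /= l1 l3 /=; rewrite -tF addnCA addKn.
  move=> [W [[F1 F2]]]; rewrite mem_filter mem_windows mem_forest_pairs /=.
  move=> [/andP[/andP[QW tW] /andP[/eqP sW lW]] /and3P[l1 l2 /eqP tF] [-> ->]].
  rewrite -/(heights_le k _) -/(nleaves _) !heights_le_cat l1 l2 lW
    !nleaves_cat !size_cat sW /window /=.
  rewrite addnK drop_size_cat // take_size_cat // QW; lia.
by rewrite size_allpairs_dep sumnE big_map.
Qed.

(** A forest has at most a + b positions that lack a window: the first a and
    the last b. *)
Lemma count_boundary (a b k n : nat) :
  (count (fun v => ~~ has_window a b v) (BB n k) <= (a + b) * nforests k n)%N.
Proof.
rewrite -size_filter.
pose s := [seq (F, i) | F <- forests k n, i <- iota 0 a] ++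
          [seq (F, size F - i.+1)%N | F <- forests k n, i <- iota 0 b].
have -> : ((a + b) * nforests k n)%N = size s.
  by rewrite size_cat !size_allpairs !size_iota mulnC mulnDr.
apply: uniq_leq_size; first by rewrite filter_uniq // fset_uniq.
move=> [F i]; rewrite mem_filter mem_BB /in_BB /has_window /= => /andP[hw /and3P[iF tF lF]].
have FF : F \in forests k n by rewrite mem_forests /heights_le lF.
rewrite mem_cat; move: hw; rewrite negb_and -ltnNge => /orP[ia|ib].
  by rewrite allpairs_f // mem_iota.
apply/orP; right; apply/allpairsP; exists (F, size F - i.+1)%N => /=.
by rewrite FF mem_iota; split=> //; [lia|congr (_, _); lia].
Qed.

Definition tree_series (R : realType) (k : nat) (x : R) : R :=
  \sum_(t <- trees_upto k) x ^+ leaves t.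

(** In this section r is the positive root of the tree polynomial, which turns
    the counting recurrence of forests into a renewal equation. *)
Section Asymptotics.
Variables (R : realType) (k : nat) (r : R).
Hypothesis r_gt0 : 0 < r.
Hypothesis r_root : tree_series k r = 1.

Lemma forests_renewal :
  exists2 L : R, 0 < L & (fun n => (nforests k n)%:R * r ^+ n) @ \oo --> L.
Proof.
apply: (@renewal_theorem R _ (trees_upto k) (fun t => r ^+ leaves t) leaves
  (\max_(t <- trees_upto k) leaves t) Leaf) => //.
- by move=> t; rewrite exprn_ge0 // ltW.
- exact: leaves_gt0.
- by move=> t tk; apply: leq_bigmax_seq.
- by rewrite mem_trees_uptoE.
- by rewrite nforests0 expr0 mulr1.
- move=> n n0; rewrite nforestsS // natr_sum mulr_suml.
  apply: eq_bigr => t tn; rewrite -[in r ^+ n](subnKC tn) exprD; ring.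
Qed.

Variable L : R.
Hypothesis cvL : (fun n => (nforests k n)%:R * r ^+ n) @ \oo --> L.

Let u n := (nforests k n)%:R * r ^+ n.

Lemma size_forest_pairs_weighted n : (size (forest_pairs k n))%:R * r ^+ n = autoconv u n.
Proof.
rewrite size_forest_pairs natr_sum mulr_suml; apply: eq_bigr => j _.
have jn : (j <= n)%N by rewrite -ltnS.
have -> : r ^+ n = r ^+ j * r ^+ (n - j) by rewrite -exprD subnKC.
by rewrite natrM /u; ring.
Qed.

(** The set S n may be arbitrary on the markers without a window: there are
    only O(1 / r ^ n) of these, and the count grows like n / r ^ n. *)
Lemma windowed_cvg (a b : nat) (S : nat -> pred mforest) (Q : pred (seq tree)) :
  (forall n v, v \in BB n k -> has_window a b v -> S n v = Q (window a b v)) ->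
  (count (S n) (BB n k))%:R * r ^+ n / n.+1%:R @[n --> \oo] -->
    L ^+ 2 * \sum_(W <- windows k (width a b) | Q W) r ^+ nleaves W.
Proof.
move=> HS.
rewrite -[X in _ --> X]addr0.
have cnt n : count (S n) (BB n k) =
    (count (fun v => has_window a b v && Q (window a b v)) (BB n k) +
     count (fun v => ~~ has_window a b v && S n v) (BB n k))%N.
  rewrite -[LHS]size_filter -(count_predC (has_window a b)) !count_filter.
  congr (_ + _)%N; apply: eq_in_count => v vB //=.
  by case: (boolP (has_window a b v)) => //= /(HS _ _ vB).
under eq_fun do rewrite cnt natrD 2!mulrDl.
apply: cvgD; last first.
  apply: (@vanish_bounded _ _ _ cvL _ (a + b)%:R) => n.
  rewrite mulr_ge0 ?ler0n ?exprn_ge0 ?(ltW r_gt0) //= mulrA ler_wpM2r ?exprn_ge0 ?(ltW r_gt0) //.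
  rewrite -natrM ler_nat; apply: leq_trans (count_boundary a b k n).
  by apply: sub_count => v /= /andP[].
under eq_fun do rewrite count_windowed natr_sum big_mkcondr 2!mulr_suml /=.
rewrite mulr_sumr; apply: cvg_big => [|W _]; first exact: add_continuous.
rewrite [L ^+ 2 * _]mulrC.
apply: cvg_trans (cvgM (cvg_cst (r ^+ nleaves W)) (autoconv_shift cvL (nleaves W))).
apply: near_eq_cvg; near=> n.
have Wn : (nleaves W <= n)%N by near: n; exact: nbhs_infty_ge.
rewrite /= Wn -[autoconv _ _]size_forest_pairs_weighted -[in r ^+ n](subnKC Wn) exprD.
by rewrite [LHS]mulrA; congr (_ / _); ring.
Unshelve. all: by end_near.
Qed.

End Asymptotics.

(** * Edges as marker shifts and splits *)

Definition shift_marker (v : mforest) : mforest := (v.1, v.2.+1).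
Definition marks_node (v : mforest) : bool := nth Leaf v.1 v.2 != Leaf.
Definition split_of (v : mforest) : mforest :=
  if nth Leaf v.1 v.2 is Node A B then
    (take v.2 v.1 ++ [:: A; B] ++ drop v.2.+1 v.1, v.2)
  else v.

Lemma horizontalE v v' : horizontal v v' = (v' == shift_marker v).
Proof. by case: v v' => [F i] [G j]; rewrite /horizontal /shift_marker xpair_eqE. Qed.

Lemma splitsE v v' : splits v v' = marks_node v && (v' == split_of v).
Proof.
by rewrite /splits /marks_node /split_of; case: (nth _ _ _) => [|A B] //=; rewrite eqxx.
Qed.

Lemma marks_node_lt v : marks_node v -> (v.2 < size v.1)%N.
Proof. by apply: contraNT; rewrite -leqNgt => /(nth_default _) ->. Qed.

Lemma size_split_of v : marks_node v -> size (split_of v).1 = (size v.1).+1.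
Proof.
move=> nv; have := marks_node_lt nv; move: nv; rewrite /split_of /marks_node.
case: (nth _ _ _) => // A B _ iF /=.
by rewrite size_cat /= size_take size_drop iF; lia.
Qed.

(** In an unordered pair {x, f x} the end of smaller rank is x. The two uses
    rank by the position of the marker, for shifts, and by the number of trees,
    for splits. *)
Lemma fset2_rank_inj (T : choiceType) (f g : T -> T) (rank : T -> nat) x y :
  (rank x < rank (f x))%N -> (rank y < rank (g y))%N ->
  [fset x; f x]%fset = [fset y; g y]%fset -> x = y.
Proof.
move=> rx ry e.
have : x \in [fset y; g y]%fset by rewrite -e !inE eqxx.
have : y \in [fset x; f x]%fset by rewrite e !inE eqxx.
rewrite !inE => /orP[/eqP //|/eqP yx] /orP[/eqP //|/eqP xy].
by move: rx ry; rewrite -xy -yx => rx /(ltn_trans rx); rewrite ltnn.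
Qed.

(** A shift keeps the forest and a split lengthens it, so no edge is of both
    kinds, and each edge has a single lower end. *)
Lemma card_edges (Y : {fset mforest}) :
  #|` edges Y| = (count (fun v => shift_marker v \in Y) Y
                  + count (fun v => marks_node v && (split_of v \in Y)) Y)%N.
Proof.
pose h v := [fset v; shift_marker v]%fset; pose s v := [fset v; split_of v]%fset.
pose Yh := [seq v <- Y | shift_marker v \in Y].
pose Ys := [seq v <- Y | marks_node v && (split_of v \in Y)].
have /perm_size : perm_eq (edges Y) (map h Yh ++ map s Ys); last first.
  by rewrite size_cat !size_map !size_filter.
apply: uniq_perm; first exact: fset_uniq.
  rewrite cat_uniq; apply/and3P; split.
  - rewrite map_inj_in_uniq ?filter_uniq ?fset_uniq // => v w _ _.
    exact: (@fset2_rank_inj _ _ _ snd).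
  - apply/hasPn => _ /mapP[w + ->]; rewrite mem_filter => /andP[/andP[nw _] _].
    apply/negP => /mapP[v _ e].
    have : w \in h v by rewrite -e !inE eqxx.
    have : split_of w \in h v by rewrite -e !inE eqxx orbT.
    have := size_split_of nw.
    by rewrite !inE => sw /orP[]/eqP e1 /orP[]/eqP e2; move: sw; rewrite e1 e2 /=; lia.
  - rewrite map_inj_in_uniq ?filter_uniq ?fset_uniq // => v w.
    rewrite !mem_filter => /andP[/andP[nv _] _] /andP[/andP[nw _] _].
    by apply: (@fset2_rank_inj _ _ _ (fun v => size v.1)); rewrite size_split_of.
move=> e; apply/idP/idP.
  move=> /edgesP[x [y [xY yY + ->]]]; rewrite mem_cat /adj !horizontalE !splitsE.
  have hor u v : u \in Y -> v \in Y -> v = shift_marker u -> [fset u; v]%fset \in map h Yh.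
    by move=> uY vY ev; apply/mapP; exists u; rewrite ?mem_filter -?ev ?uY ?vY // /h -ev.
  have ver u v : u \in Y -> v \in Y -> marks_node u -> v = split_of u ->
      [fset u; v]%fset \in map s Ys.
    by move=> uY vY nu ev; apply/mapP; exists u; rewrite ?mem_filter -?ev ?uY ?vY ?nu // /s -ev.
  case/or4P => [/eqP e1|/eqP e1|/andP[nx /eqP e1]|/andP[ny /eqP e1]].
  - by rewrite hor.
  - by rewrite fsetUC hor.
  - by rewrite ver ?orbT.
  - by rewrite fsetUC ver ?orbT.
rewrite mem_cat => /orP[] /mapP[v]; rewrite mem_filter.
  move=> /andP[nY vY] ->; apply/edgesP; exists v, (shift_marker v); split=> //.
  by rewrite /adj horizontalE eqxx.
move=> /andP[/andP[nv sY] vY] ->; apply/edgesP; exists v, (split_of v); split=> //.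
by rewrite /adj !splitsE nv eqxx !orbT.
Qed.

Lemma split_of_BB n k v : v \in BB n k -> marks_node v -> split_of v \in BB n k.
Proof.
move=> + nv; have := marks_node_lt nv; move: nv.
rewrite !mem_BB /in_BB => nv iF /and3P[_ /eqP tF lF].
have sz := size_split_of nv.
rewrite sz; move: nv; rewrite /marks_node /split_of.
move: (drop_nth Leaf iF) tF lF; case: v iF {sz} => F i /= iF.
case: (nth _ _ _) => [|A B] //= dF; rewrite -{1 2}(cat_take_drop i F) dF.
rewrite !map_cat !sumn_cat !all_cat /= => <- /and3P[-> hAB ->] _.
move: hAB; rewrite gtn_max => /andP[hA hB].
rewrite (ltnW hA) (ltnW hB) !andbT. lia.
Qed.

(** Membership in U for bare sequences: the types at the two ends of an edge are
    obtained by cutting longer words, whose sizes are not syntactically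
    [width a b]. *)
Definition has_type (w : nat) (U : {set word w}) (s : seq category) : bool :=
  s \in [seq tval u | u <- enum U].

Lemma has_type_val w (U : {set word w}) (u : word w) : has_type U u = (u \in U).
Proof. by rewrite /has_type mem_map ?mem_enum //; exact: val_inj. Qed.

Lemma type_of_window a b k v : has_window a b v ->
  tval (type_of a b k v) = map (category_of k) (window a b v).
Proof.
move=> /andP[av bv].
have sz : size (window a b v) = width a b.
  by rewrite /window size_takel // size_drop; lia.
apply: (@eq_from_nth _ catE); first by rewrite size_map sz size_tuple.
move=> j; rewrite size_tuple => jw.
rewrite (nth_map Leaf) ?sz // nth_take // nth_drop.
by rewrite -[j]/(val (Ordinal jw)) -tnth_nth tnth_mktuple.
Qed.

Definition split_window (a b : nat) (W : seq tree) : seq tree :=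
  if nth Leaf W a is Node X Y then
    take a W ++ take b.+1 [:: X, Y & drop a.+1 W]
  else W.

Lemma has_windowP a b v : has_window a b v ->
  exists P A t B Z, [/\ v = (P ++ A ++ t :: B ++ Z, size P + size A)%N,
                        size A = a & size B = b].
Proof.
case: v => F i /andP[/= ai ib].
have iF : (i < size F)%N by lia.
exists (take (i - a) F), (take a (drop (i - a) F)), (nth Leaf F i),
  (take b (drop i.+1 F)), (drop b (drop i.+1 F)).
have s1 : size (take a (drop (i - a) F)) = a by rewrite size_takel // size_drop; lia.
split=> //; last by rewrite size_takel // size_drop; lia.
rewrite s1 size_takel ?subnK //; last by lia.
rewrite cat_take_drop -drop_nth // catA -takeD subnK //.
by rewrite cat_take_drop.
Qed.

Lemma window_cat P A t B Z :
  window (size A) (size B) (P ++ A ++ t :: B ++ Z, size P + size A)%N = A ++ t :: B.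
Proof.
rewrite /window /= addnK drop_size_cat // -cat_cons catA take_size_cat //.
by rewrite size_cat /= addnS.
Qed.

Lemma nth_window a b v : has_window a b v -> nth Leaf (window a b v) a = nth Leaf v.1 v.2.
Proof.
move=> /andP[av bv]; rewrite /window nth_take; last by lia.
by rewrite nth_drop subnK.
Qed.

(** Splitting lengthens the part to the right of the marker, so it never
    destroys the window; both children enter the new window, which is then cut
    back to its width. *)
Lemma split_of_window a b v : has_window a b v -> marks_node v ->
  has_window a b (split_of v) /\
  window a b (split_of v) = split_window a b (window a b v).
Proof.
move=> /has_windowP[P [A [t [B [Z [-> <- <-]]]]]].
have nth_mid (F : seq tree) G : nth Leaf (F ++ t :: G) (size F) = t.
  by rewrite nth_cat ltnn subnn.
have drop_mid (F : seq tree) G : drop (size F).+1 (F ++ t :: G) = G.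
  by rewrite -add1n -drop_drop drop_size_cat //= drop0.
rewrite window_cat /marks_node /split_of /split_window /=.
rewrite [P ++ _]catA -size_cat !nth_mid !drop_mid !take_size_cat //.
case: t {nth_mid drop_mid} => [//|X Y] _.
split; first by rewrite /has_window /= !size_cat /= size_cat leq_addl /=; lia.
rewrite /window /= size_cat addnK -catA drop_size_cat //.
rewrite -addnS take_cat ltnNge leq_addr /= addKn; congr (_ ++ _).
by rewrite /= -[Y :: B ++ Z]cat_cons takel_cat /=.
Qed.

(** A window with one more tree on the right contains the windows of both ends
    of a horizontal edge. *)
Lemma has_window_shift a b v : has_window a b.+1 v ->
  [/\ has_window a b v, has_window a b (shift_marker v),
      window a b v = take (width a b) (window a b.+1 v)
    & window a b (shift_marker v) = drop 1 (window a b.+1 v)].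
Proof.
case: v => F i; rewrite /has_window /window /= => /andP[ai ib].
split; [lia|lia| |]; first by rewrite take_takel // addnS.
rewrite addnS -[(a + b).+2]addn1 -[X in X = _]/(take (width a b) (drop (i.+1 - a) F)).
rewrite -take_drop drop_drop add1n subSn //.
Qed.

Lemma has_windowW a b v : has_window a b v -> (v.2 < size v.1)%N.
Proof. by move=> /andP[_]; lia. Qed.

Lemma shift_marker_BB n k v : v \in BB n k -> (v.2.+1 < size v.1)%N -> shift_marker v \in BB n k.
Proof. by rewrite !mem_BB /in_BB /= => /and3P[_ -> ->] ->. Qed.

(** * The inner limit as a ratio of sums over windows *)

Section RetainedDensity.
Variables (R : realType) (a b : nat) (conv : convention a b).
Variables (U : {set word (width a b)}) (k : nat).

Definition keep (n : nat) (v : mforest) : bool :=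
  if has_window a b v then type_of a b k v \in U else conv U n k v.

Lemma mem_retained n v : (v \in retained conv U n k) = (v \in BB n k) && keep n v.
Proof. by rewrite !inE. Qed.

Lemma perm_retained n : perm_eq (retained conv U n k) [seq v <- BB n k | keep n v].
Proof.
apply: uniq_perm; rewrite ?filter_uniq ?fset_uniq // => v.
by rewrite mem_retained mem_filter andbC.
Qed.

Lemma card_retained n : #|` retained conv U n k| = count (keep n) (BB n k).
Proof. by rewrite (perm_size (perm_retained n)) size_filter. Qed.

Lemma count_retained n p :
  count p (retained conv U n k) = count (fun v => keep n v && p v) (BB n k).
Proof.
rewrite (permP (perm_retained n)) count_filter; apply: eq_count => v.
by rewrite /= andbC.
Qed.

Definition categories (W : seq tree) : seq category := map (category_of k) W.

Lemma keep_window n v : has_window a b v -> keep n v = has_type U (categories (window a b v)).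
Proof. by move=> hw; rewrite /keep hw -has_type_val type_of_window. Qed.

Definition vertexQ (W : seq tree) := has_type U (categories W).
Definition horizontalQ (W : seq tree) :=
  has_type U (categories (take (width a b) W)) && has_type U (categories (drop 1 W)).
Definition verticalQ (W : seq tree) :=
  [&& has_type U (categories W), nth Leaf W a != Leaf &
      has_type U (categories (split_window a b W))].

Variable r : R.
Hypothesis r_gt0 : 0 < r.
Hypothesis r_root : tree_series k r = 1.

Definition window_mass w (Q : pred (seq tree)) : R := \sum_(W <- windows k w | Q W) r ^+ nleaves W.

(** Vertices, horizontal edges and vertical edges are counted by three
    applications of [windowed_cvg]; the common factor L ^ 2 cancels. *)
Lemma dens_cvg : 0 < window_mass (width a b) vertexQ ->
  dens R (retained conv U n k) @[n --> \oo] -->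
    2 * (window_mass (width a b).+1 horizontalQ + window_mass (width a b) verticalQ)
      / window_mass (width a b) vertexQ.
Proof.
move=> V0; have [L L0 cvL] := forests_renewal r_gt0 r_root.
pose x n := r ^+ n / n.+1%:R.
have x0 n : x n != 0 by rewrite mulf_neq0 ?invr_eq0 ?pnatr_eq0 // expf_neq0 // gt_eqF.
have cvV : ((#|` retained conv U n k|)%:R * x n) @[n --> \oo] -->
    L ^+ 2 * window_mass (width a b) vertexQ.
  under eq_fun do rewrite card_retained mulrA.
  by apply: (windowed_cvg r_gt0 cvL) => n v _; exact: keep_window.
have cvH : ((count (fun v => shift_marker v \in retained conv U n k) (retained conv U n k))%:R
     * x n) @[n --> \oo] --> L ^+ 2 * window_mass (width a b).+1 horizontalQ.
  rewrite -addnS; under eq_fun do rewrite count_retained mulrA.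
  apply: (windowed_cvg (b := b.+1) r_gt0 cvL) => n v vB hw.
  have [h1 h2 w1 w2] := has_window_shift hw.
  rewrite mem_retained !keep_window // w1 w2 shift_marker_BB //.
  exact: has_windowW h2.
have cvE : ((count (fun v => marks_node v && (split_of v \in retained conv U n k))
     (retained conv U n k))%:R * x n) @[n --> \oo] --> L ^+ 2 * window_mass (width a b) verticalQ.
  under eq_fun do rewrite count_retained mulrA.
  apply: (windowed_cvg r_gt0 cvL) => n v vB hw.
  rewrite keep_window // /verticalQ nth_window //; congr (_ && _).
  rewrite -/(marks_node v); case: (boolP (marks_node v)) => //= nv.
  have [h2 w2] := split_of_window hw nv.
  by rewrite mem_retained split_of_BB // keep_window // w2.
have L2 : L ^+ 2 != 0 by rewrite expf_neq0 // gt_eqF.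
have -> : 2 * (window_mass (width a b).+1 horizontalQ + window_mass (width a b) verticalQ)
      / window_mass (width a b) vertexQ =
   2 * (L ^+ 2 * window_mass (width a b).+1 horizontalQ
      + L ^+ 2 * window_mass (width a b) verticalQ)
      / (L ^+ 2 * window_mass (width a b) vertexQ).
  by field; rewrite ?gt_eqF.
have V2 : L ^+ 2 * window_mass (width a b) vertexQ != 0 by rewrite mulf_neq0 // gt_eqF.
apply: cvg_trans (cvgM (cvgM (cvg_cst (2 : R)) (cvgD cvH cvE)) (cvgV V2 cvV)).
apply: near_eq_cvg; near=> n => /=.
rewrite /dens card_edges natrD !fctE -mulrDl.
by rewrite mulrA -mulf_div divff // mulr1.
Unshelve. all: by end_near.
Qed.
End RetainedDensity.

(** * From windows of trees to words of categories *)

Lemma sum_tuple_cons (R : nmodType) (T : finType) n (F : n.+1.-tuple T -> R) :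
  \sum_s F s = \sum_x \sum_(s : n.-tuple T) F (cons_tuple x s).
Proof.
rewrite pair_big /= (reindex (fun p : T * n.-tuple T => cons_tuple p.1 p.2)) //.
exists (fun s => (thead s, behead_tuple s)) => [[x s] _|s _] /=.
  by congr (_, _); apply: val_inj.
by rewrite [RHS]tuple_eta.
Qed.

Lemma sum_by_value (R : pzSemiRingType) (I : Type) (T : finType) (s : seq I)
    (g : I -> T) (f : I -> R) (psi : T -> R) :
  \sum_(i <- s) psi (g i) * f i = \sum_c psi c * \sum_(i <- s | g i == c) f i.
Proof.
rewrite (partition_big g predT) //=; apply: eq_bigr => c _.
by rewrite mulr_sumr; apply: eq_bigr => i /eqP ->.
Qed.

Definition weight (R : pzSemiRingType) (p : category -> R) (s : seq category) : R :=
  \prod_(c <- s) p c.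

Section WindowSums.
Variables (R : realType) (k : nat) (r : R).

Definition cat_mass (m : nat) (c : category) : R :=
  \sum_(t <- trees_upto m | category_of k t == c) r ^+ leaves t.

Definition node_mass (m : nat) (t i j : category) : R :=
  \sum_(X <- trees_upto m) \sum_(Y <- trees_upto m
      | [&& category_of k (Node X Y) == t, category_of k X == i & category_of k Y == j])
    r ^+ (leaves X + leaves Y).

(** The weight of a window is a product over its trees, so summing over the
    trees of each category separately replaces trees by letters. *)
Lemma windows_sum w (psi : seq category -> R) :
  \sum_(W <- windows k w) psi (categories k W) * r ^+ nleaves W =
  \sum_(c : word w) psi c * weight (cat_mass k) c.
Proof.
elim: w psi => [|w IH] psi /=.
  rewrite big_seq1 (eq_bigl (pred1 [tuple])); last first.
    by move=> c; apply/esym/eqP; exact: tuple0.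
  by rewrite big_pred1_eq /weight big_nil.
rewrite big_allpairs_dep sum_tuple_cons.
under eq_bigr => t _.
  under eq_bigr => W _ do rewrite [nleaves _]/= exprD mulrCA.
  rewrite -mulr_sumr (IH (fun s => psi (category_of k t :: s))) mulrC.
  over.
rewrite (sum_by_value _ _ _ (fun c0 => \sum_(c : word w) psi (c0 :: c) * weight (cat_mass k) c)).
apply: eq_bigr => c0 _; rewrite mulr_suml; apply: eq_bigr => c _.
by rewrite /weight big_cons -/(cat_mass k c0); ring.
Qed.

Lemma windows_sum_cond w (phi : pred (seq category)) :
  \sum_(W <- windows k w | phi (categories k W)) r ^+ nleaves W =
  \sum_(c : word w | phi c) weight (cat_mass k) c.
Proof.
rewrite big_mkcond [RHS]big_mkcond.
have := windows_sum w (fun s => (phi s)%:R) => e.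
transitivity (\sum_(W <- windows k w) (phi (categories k W))%:R * r ^+ nleaves W).
  by apply: eq_bigr => W _; case: (phi _); rewrite ?mul1r ?mul0r.
by rewrite e; apply: eq_bigr => c _; case: (phi _); rewrite ?mul1r ?mul0r.
Qed.

Lemma windows_cat m n (F : seq tree -> R) :
  \sum_(W <- windows k (m + n)) F W =
  \sum_(A <- windows k m) \sum_(B <- windows k n) F (A ++ B).
Proof.
elim: m F => [|m IH] F; first by rewrite big_seq1.
rewrite /= !big_allpairs_dep; apply: eq_bigr => t _.
by rewrite IH.
Qed.
End WindowSums.

Section Formula.
Variables (R : realType) (a b : nat) (U : {set word (width a b)}).

Definition vertex_sum (p : category -> R) : R := \sum_(u in U) weight p u.
Definition horizontal_sum (p : category -> R) : R :=
  \sum_(z : word (width a b).+1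
     | has_type U (take (width a b) z) && has_type U (drop 1 z)) weight p z.
Definition vertical_sum (p : category -> R) (q : category -> category -> category -> R) : R :=
  \sum_(A : word a) \sum_(B : word b) \sum_t \sum_i \sum_(j
      | has_type U (A ++ t :: B) && has_type U (A ++ take b.+1 [:: i, j & B]))
    weight p (A ++ B) * q t i j.

Variables (k : nat) (r : R).

Lemma vertex_mass :
  window_mass k r (width a b) (vertexQ U k) = vertex_sum (cat_mass k r k).
Proof.
rewrite /window_mass /vertexQ windows_sum_cond; apply: eq_bigl => u.
by rewrite has_type_val.
Qed.

Lemma horizontal_mass :
  window_mass k r (width a b).+1 (horizontalQ U k) = horizontal_sum (cat_mass k r k).
Proof.
rewrite /window_mass /horizontal_sum -(windows_sum_cond _ _ _ (fun z =>
   has_type U (take (width a b) z) && has_type U (drop 1 z))).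
by apply: eq_bigl => W; rewrite /horizontalQ /categories map_take map_drop.
Qed.

End Formula.

Lemma nth_mid (A B : seq tree) t : nth Leaf (A ++ t :: B) (size A) = t.
Proof. by rewrite nth_cat ltnn subnn. Qed.

Lemma split_window_cat (A B : seq tree) X Y b :
  split_window (size A) b (A ++ Node X Y :: B) = A ++ take b.+1 [:: X, Y & B].
Proof.
rewrite /split_window nth_mid take_size_cat //.
by rewrite -[(size A).+1]add1n -drop_drop drop_size_cat //= drop0.
Qed.

(** The window is cut at the marker into A, the marked tree and B. The marked
    tree is a node on two trees of height at most k, and the two types depend on
    them only through the categories of the node and of its children. *)
Lemma vertical_mass (R : realType) (a b : nat) (U : {set word (width a b)}) k (r : R) :
  window_mass k.+1 r (width a b) (verticalQ U k.+1) =
  vertical_sum U (cat_mass k.+1 r k.+1) (node_mass k.+1 r k).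
Proof.
set K := k.+1.
pose phi (A B : seq category) (c : category * category * category) : R :=
  (has_type U (A ++ c.1.1 :: B) && has_type U (A ++ take b.+1 [:: c.1.2, c.2 & B]))%:R.
pose psi (A B : seq category) : R := \sum_(X <- trees_upto k) \sum_(Y <- trees_upto k)
  phi A B (category_of K (Node X Y), category_of K X, category_of K Y)
    * r ^+ (leaves X + leaves Y).
have psiE A B : psi A B = \sum_t \sum_i \sum_j phi A B (t, i, j) * node_mass K r k t i j.
  pose g (p : tree * tree) :=
    (category_of K (Node p.1 p.2), category_of K p.1, category_of K p.2).
  transitivity (\sum_(p <- [seq (X, Y) | X <- trees_upto k, Y <- trees_upto k])
      phi A B (g p) * r ^+ (leaves p.1 + leaves p.2)); first by rewrite big_allpairs_dep.
  rewrite sum_by_value !pair_big /=; apply: eq_bigr => [[[t i] j] _].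
  rewrite big_mkcond big_allpairs_dep /=; congr (_ * _); apply: eq_bigr => X _.
  rewrite [RHS]big_mkcond; apply: eq_bigr => Y _.
  by rewrite /g !xpair_eqE -andbA.
transitivity (\sum_(A <- windows K a)
  (\sum_(B <- windows K b) psi (categories K A) (categories K B) * r ^+ nleaves B)
    * r ^+ nleaves A).
  rewrite /window_mass big_mkcond -addnS windows_cat.
  rewrite big_seq [RHS]big_seq; apply: eq_bigr => A; rewrite mem_windows => /andP[/eqP sA _].
  have -> : windows K b.+1 = [seq t :: W | t <- trees_upto K, W <- windows K b] by [].
  have -> : trees_upto K = Leaf :: [seq Node X Y | X <- trees_upto k, Y <- trees_upto k].
    by [].
  rewrite big_allpairs_dep exchange_big mulr_suml; apply: eq_bigr => B _.
  have vQ t : verticalQ U K (A ++ t :: B) =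
    [&& has_type U (categories K A ++ category_of K t :: categories K B), t != Leaf &
        has_type U (categories K (split_window a b (A ++ t :: B)))].
    have nA : nth Leaf (A ++ t :: B) a = t by rewrite -sA nth_mid.
    by rewrite /verticalQ nA /categories map_cat.
  rewrite big_cons vQ /= andbF add0r /psi big_allpairs_dep !mulr_suml.
  apply: eq_bigr => X _; rewrite !mulr_suml; apply: eq_bigr => Y _.
  rewrite vQ; have -> : split_window a b (A ++ Node X Y :: B) = A ++ take b.+1 [:: X, Y & B].
    by rewrite -sA split_window_cat.
  rewrite /phi /categories !map_cat map_take.
  rewrite nleaves_cat /nleaves /= -/(nleaves A) -/(nleaves B).
  by case: (_ && _); rewrite ?mul0r // mul1r !exprD; ring.
rewrite (windows_sum K r a
  (fun cA => \sum_(B <- windows K b) psi cA (categories K B) * r ^+ nleaves B)).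
apply: eq_bigr => A _; rewrite (windows_sum K r b (psi A)) mulr_suml.
apply: eq_bigr => B _; rewrite psiE !mulr_suml; apply: eq_bigr => t _.
rewrite !mulr_suml; apply: eq_bigr => i _.
rewrite !mulr_suml [RHS]big_mkcond; apply: eq_bigr => j _.
rewrite /phi /=; case: (_ && _); rewrite ?mul0r // mul1r /weight big_cat /=.
by ring.
Qed.

(** * The tree polynomials and the weights of categories *)

Section TreeSeries.
Variable R : realType.
Implicit Types (x : R) (k : nat).

Lemma tree_seriesS k x : tree_series k.+1 x = x + tree_series k x ^+ 2.
Proof.
rewrite /tree_series /= big_cons big_allpairs_dep expr2 mulr_suml; congr (_ + _).
apply: eq_bigr => X _; rewrite mulr_sumr; apply: eq_bigr => Y _.
by rewrite exprD.
Qed.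

Lemma tree_series0 x : tree_series 0 x = x.
Proof. by rewrite /tree_series big_seq1. Qed.

Lemma tree_series_ge k x : 0 <= x -> x <= tree_series k x.
Proof. by case: k => [|k] x0; rewrite ?tree_series0 // tree_seriesS lerDl sqr_ge0. Qed.

Lemma tree_series_le_half k x : 0 <= x <= 1 / 4 -> tree_series k x <= 1 / 2.
Proof.
move=> /andP[x0 x4]; elim: k => [|k IH]; first by rewrite tree_series0; lra.
have := tree_series_ge k x0; rewrite tree_seriesS => xT; nra.
Qed.

(** Each step adds x - T + T^2 >= x - 1/4. *)
Lemma tree_series_growth k x : 0 <= x -> k%:R * (x - 1 / 4) <= tree_series k x.
Proof.
move=> x0; elim: k => [|k IH]; first by rewrite mul0r tree_series0.
rewrite tree_seriesS -natr1; have := sqr_ge0 (tree_series k x - 1 / 2); nra.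
Qed.

(** These two bounds force the roots to tend to 1/4. *)
Lemma tree_series_root k :
  exists2 r : R, tree_series k r = 1 & 1 / 4 <= r /\ k%:R * (r - 1 / 4) <= 1.
Proof.
pose p : {poly R} := (\sum_(t <- trees_upto k) 'X^(leaves t)) - 1.
have pE x : p.[x] = tree_series k x - 1.
  rewrite /p hornerD hornerN hornerC horner_sum; congr (_ - _).
  by apply: eq_bigr => t _; rewrite hornerXn.
have [r /andP[r0 r1] /rootP] : exists2 x, 0 <= x <= 1 & root p x.
  have T0 : tree_series k 0 = 0 :> R.
    elim: k {p pE} => [|k IH]; first by rewrite tree_series0.
    by rewrite tree_seriesS IH expr0n addr0.
  apply: poly_ivt; rewrite ?ler01 // !pE T0 sub0r lerN10 subr_ge0 //=.
  exact: tree_series_ge.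
rewrite pE => /eqP; rewrite subr_eq0 => /eqP rT; exists r => //.
split; last by have := tree_series_growth k r0; rewrite rT.
rewrite leNgt; apply/negP => r4.
by have := @tree_series_le_half k r; rewrite rT; lra.
Qed.

End TreeSeries.

Section CategoryMasses.
Variables (R : realType) (k : nat) (r : R).
Let K := k.+2.

Lemma big_trees_low m n (F : tree -> R) : (m <= n)%N ->
  \sum_(t <- trees_upto n | (height t <= m)%N) F t = \sum_(t <- trees_upto m) F t.
Proof.
move=> mn; rewrite -big_filter; apply: perm_big; apply: uniq_perm.
- by rewrite filter_uniq // trees_upto_uniq.
- exact: trees_upto_uniq.
move=> t; rewrite mem_filter !mem_trees_uptoE; apply: andb_idr => tm.
exact: leq_trans mn.
Qed.

(** The weights of the categories, for a height bound K, when the one-leaf tree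
    weighs e: [short_masses] is for the trees of height at most some m < K, of
    total weight t; [all_masses] for all trees of height at most K, of total
    weight 1, those of height less than K weighing t. In [split_masses] the
    children have height at most K - 1 (weight t1), and at most K - 2 (weight
    t2) exactly when their parent is not of full height. *)
Definition short_masses (e t : R) (c : category) : R :=
  match c with catE => e | catL => t - e | catH => 0 end.
Definition all_masses (e t : R) (c : category) : R :=
  match c with catE => e | catL => t - e | catH => 1 - t end.
Definition split_masses (e t1 t2 : R) (t i j : category) : R :=
  match t with
  | catE => 0
  | catL => short_masses e t2 i * short_masses e t2 j
  | catH => short_masses e t1 i * short_masses e t1 j
            - short_masses e t2 i * short_masses e t2 j
  end.

Lemma sum_category (F : category -> R) : \sum_c F c = F catE + F catL + F catH.
Proof.
have EL : (catE == catL) = false by apply/eqP.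
have EH : (catE == catH) = false by apply/eqP.
have LH : (catL == catH) = false by apply/eqP.
rewrite -big_enum (perm_big [:: catE; catL; catH]) /=; last first.
  apply: uniq_perm; rewrite ?enum_uniq //= ?inE ?EL ?EH ?LH //.
  by move=> c; rewrite mem_enum !inE; case: c; rewrite eqxx ?orbT.
by rewrite !big_cons big_nil addr0 addrA.
Qed.

Lemma sum_cat_mass m : \sum_c cat_mass K r m c = tree_series m r.
Proof. by rewrite /tree_series (partition_big (category_of K) predT). Qed.

Lemma cat_mass_E m : cat_mass K r m catE = r.
Proof.
have catEP t : (category_of K t == catE) = (t == Leaf).
  by apply/eqP/eqP => [|-> //]; case: t => //= A B; case: ifP.
rewrite /cat_mass; under eq_bigl do rewrite catEP.
rewrite -big_filter (_ : [seq _ <- _ | _] = [:: Leaf]) ?big_seq1 //.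
by rewrite filter_pred1_uniq ?trees_upto_uniq // mem_trees_uptoE.
Qed.

Lemma category_of_H t : (category_of K t == catH) = (height t == K).
Proof.
apply/eqP/eqP; first by case: t => //= A B; case: eqP.
by case: t => //= A B ->; rewrite eqxx.
Qed.

Lemma cat_mass_low m : (m < K)%N -> cat_mass K r m =1 short_masses r (tree_series m r).
Proof.
move=> mK; have H0 : cat_mass K r m catH = 0.
  rewrite /cat_mass big_seq_cond big1 // => t /andP[].
  by rewrite mem_trees_uptoE category_of_H => tm /eqP tK; move: mK; rewrite -tK ltnNge tm.
have := sum_cat_mass m; rewrite sum_category cat_mass_E H0 => s.
by case; rewrite /= ?cat_mass_E ?H0 // -s; ring.
Qed.

Lemma cat_mass_top : tree_series K r = 1 ->
  cat_mass K r K =1 all_masses r (tree_series k.+1 r).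
Proof.
move=> rK.
have H1 : cat_mass K r K catH = 1 - tree_series k.+1 r.
  have -> : 1 = tree_series k.+1 r + cat_mass K r K catH :> R.
    rewrite -rK {1}/tree_series (bigID (fun t => (height t <= k.+1)%N)).
    congr (_ + _); first exact: big_trees_low.
    rewrite /cat_mass big_seq_cond [RHS]big_seq_cond; apply: eq_bigl => t.
    rewrite category_of_H mem_trees_uptoE -ltnNge.
    by apply/idP/idP; rewrite /K; lia.
  by rewrite addrC addKr.
have := sum_cat_mass K; rewrite sum_category cat_mass_E H1 rK => s.
by case; rewrite /= ?cat_mass_E ?H1 //; lra.
Qed.

(** Children of a tree in L have height at most k, for the height bound
    k + 2; children of any tree have height at most k + 1, and the case H is
    the difference. *)
Lemma node_massE t i j :
  node_mass K r k.+1 t i j = split_masses r (tree_series k.+1 r) (tree_series k r) t i j.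
Proof.
set T1 := tree_series _ _; set T2 := tree_series _ _.
have node_total : \sum_t node_mass K r k.+1 t i j = short_masses r T1 i * short_masses r T1 j.
  rewrite -!cat_mass_low // /cat_mass /node_mass exchange_big mulr_suml [RHS]big_mkcond.
  apply: eq_bigr => X _.
  transitivity (\sum_(Y <- trees_upto k.+1 | (category_of K X == i) && (category_of K Y == j))
      r ^+ (leaves X + leaves Y)).
    rewrite [RHS](partition_big (fun Y => category_of K (Node X Y)) predT) //.
    by apply: eq_bigr => c _; apply: eq_bigl => Y; rewrite andbC.
  case: ifP => _ /=; last by rewrite big_pred0.
  by rewrite mulr_sumr; apply: eq_bigr => Y _; rewrite exprD.
have node_E : node_mass K r k.+1 catE i j = 0.
  rewrite /node_mass big1 // => X _; rewrite big_pred0 // => Y /=.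
  by case: eqP => //=; case: ifP.
have node_L : node_mass K r k.+1 catL i j = short_masses r T2 i * short_masses r T2 j.
  rewrite -!cat_mass_low // /cat_mass /node_mass.
  have low c : \sum_(X <- trees_upto k | category_of K X == c) r ^+ leaves X =
      \sum_(X <- trees_upto k.+1 | (height X <= k)%N && (category_of K X == c))
        r ^+ leaves X.
    by rewrite big_mkcond -(big_trees_low _ (leqnSn k)) -big_mkcondr.
  rewrite !low mulr_suml [RHS]big_mkcond big_seq [RHS]big_seq; apply: eq_bigr => X.
  rewrite mem_trees_uptoE => Xk.
  transitivity (\sum_(Y <- trees_upto k.+1 | ((height X <= k)%N && (category_of K X == i))
      && ((height Y <= k)%N && (category_of K Y == j))) r ^+ (leaves X + leaves Y)).
    rewrite big_seq_cond [RHS]big_seq_cond; apply: eq_bigl => Y.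
    rewrite mem_trees_uptoE; case: (leqP (height Y) k.+1) => //= Yk.
    have -> : ((if (maxn (height X) (height Y)).+1 == K then catH else catL) == catL) =
        (height X <= k)%N && (height Y <= k)%N.
      rewrite /K; case: ifP => /eqP e; last by rewrite eqxx; lia.
      by rewrite (negbTE (_ : catH != catL)); [lia|exact/eqP].
    by rewrite -!andbA; congr (_ && _); rewrite andbCA.
  case: ifP => _ /=; last by rewrite big_pred0.
  by rewrite mulr_sumr; apply: eq_bigr => Y _; rewrite exprD.
case: t => //=.
by move: node_total; rewrite sum_category node_E node_L => <-; ring.
Qed.

End CategoryMasses.

(** * The outer limit *)

Definition type_density (R : realType) (a b : nat) (U : {set word (width a b)})
    (p : category -> R) (q : category -> category -> category -> R) : R :=
  2 * (horizontal_sum U p + vertical_sum U p q) / vertex_sum U p.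

Lemma vertex_sum_gt0 (R : realType) (a b : nat) (U : {set word (width a b)})
    (p : category -> R) :
  (forall c, 0 < p c) -> U != finset.set0 -> 0 < vertex_sum U p.
Proof.
move=> p0 /set0Pn[u uU].
have w0 s : 0 < weight p s by apply: prodr_gt0.
by rewrite /vertex_sum (bigD1 u) //= ltr_pwDl // sumr_ge0 // => v _; apply: ltW.
Qed.

Lemma dens_cvg_type_density (R : realType) (a b : nat) (conv : convention a b)
    (U : {set word (width a b)}) (k : nat) (r : R) :
  U != finset.set0 -> 0 < r -> tree_series k.+2 r = 1 ->
  dens R (retained conv U n k.+2) @[n --> \oo] -->
    type_density U (all_masses r (tree_series k.+1 r))
      (split_masses r (tree_series k.+1 r) (tree_series k r)).
Proof.
move=> U0 r0 rT.
have pE := funext (cat_mass_top rT).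
have qE := funext (fun t => funext (fun i => funext (node_massE k r t i))).
have r_lt1 : tree_series k.+1 r < 1.
  by move: rT; rewrite tree_seriesS; have := tree_series_ge k.+1 (ltW r0); nra.
have p0 c : 0 < all_masses r (tree_series k.+1 r) c.
  case: c => //=; rewrite ?subr_gt0 // tree_seriesS ltrDl exprn_gt0 //.
  exact: lt_le_trans (tree_series_ge k (ltW r0)).
have := dens_cvg conv (U := U) r0 rT.
rewrite vertex_mass horizontal_mass vertical_mass pE qE; apply.
exact: vertex_sum_gt0.
Qed.

Section Continuity.
Variables (R : realType).
Variables (p : nat -> category -> R) (p' : category -> R).
Hypothesis cvp : forall c, p n c @[n --> \oo] --> p' c.

Lemma weight_cvg s : weight (p n) s @[n --> \oo] --> weight p' s.
Proof.
elim: s => [|c s IH].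
  rewrite /weight big_nil; under eq_fun do rewrite big_nil; exact: cvg_cst.
rewrite /weight big_cons; under eq_fun do rewrite big_cons.
exact: cvgM.
Qed.

Variables (a b : nat) (U : {set word (width a b)}).
Variables (q : nat -> category -> category -> category -> R).
Variable (q' : category -> category -> category -> R).
Hypothesis cvq : forall t i j, q n t i j @[n --> \oo] --> q' t i j.

Lemma type_density_cvg : vertex_sum U p' != 0 ->
  type_density U (p n) (q n) @[n --> \oo] --> type_density U p' q'.
Proof.
move=> V0.
apply: cvgM; last apply: cvgV => //.
  apply: cvgM; first exact: cvg_cst.
  apply: cvgD.
    apply: cvg_big => [|z _]; [exact: add_continuous|exact: weight_cvg].
  do 5 (apply: cvg_big => [|? _]; first exact: add_continuous).
  by apply: cvgM => //; exact: weight_cvg.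
apply: cvg_big => [|z _]; [exact: add_continuous|exact: weight_cvg].
Qed.
End Continuity.

Section LimitWeights.
Variable R : realType.

Lemma sqrt3_sq : Num.sqrt 3 ^+ 2 = 3 :> R.
Proof. by rewrite sqr_sqrtr. Qed.

Lemma sqrt3_ge0 : 0 <= Num.sqrt 3 :> R. Proof. exact: sqrtr_ge0. Qed.

Lemma pcatE : pcat R = all_masses (1 / 4) (Num.sqrt 3 / 2).
Proof. by apply: funext; case. Qed.

Lemma kappaE : kappa R = split_masses (1 / 4) (u1 R) (u2 R).
Proof. by do 3 (apply: funext; case). Qed.

Lemma pcat_gt0 c : 0 < pcat R c.
Proof. by have := sqrt3_sq; have := sqrt3_ge0; case: c => /=; nra. Qed.

Lemma u1E : u1 R = Num.sqrt (1 - 1 / 4).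
Proof.
apply/eqP; rewrite -(eqrXn2 (_ : 0 < 2)%N) ?sqrtr_ge0 //; last first.
  by rewrite divr_ge0 ?sqrt3_ge0.
rewrite sqr_sqrtr; last by lra.
by apply/eqP; rewrite /u1 expr_div_n sqrt3_sq; field.
Qed.

(** This and the previous lemma recognize u_1 and u_2 as the limits of
    T_(k-1)(r) = sqrt (1 - r) and T_(k-2)(r) = sqrt (T_(k-1)(r) - r). *)
Lemma u2E : u2 R = Num.sqrt (u1 R - 1 / 4).
Proof.
have h3 := sqrt3_sq; have h0 := sqrt3_ge0.
have h1 : 1 <= Num.sqrt 3 :> R by nra.
apply/eqP; rewrite -(eqrXn2 (_ : 0 < 2)%N) ?sqrtr_ge0 ?divr_ge0 ?sqrtr_ge0 //.
rewrite /u1 /u2 expr_div_n !sqr_sqrtr; [|lra|lra].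
by apply/eqP; field.
Qed.

Lemma D_type_density (a b : nat) (conv : convention a b) (U : {set word (width a b)}) :
  U != finset.set0 ->
  D_exists R conv U /\ D R conv U = type_density U (pcat R) (kappa R).
Proof.
move=> U0.
have [r rP] : exists r : nat -> R, forall k, tree_series k (r k) = 1 /\
    (1 / 4 <= r k /\ k%:R * (r k - 1 / 4) <= 1).
  have /choice[r rP] : forall k, exists x : R, tree_series k x = 1 /\
    (1 / 4 <= x /\ k%:R * (x - 1 / 4) <= 1).
    by move=> k; have [x x1 x2] := tree_series_root R k; exists x.
  by exists r.
pose e m := r m.+2; pose t1 m := tree_series m.+1 (e m); pose t2 m := tree_series m (e m).
have e0 m : 0 < e m by rewrite /e; have [_ [h _]] := rP m.+2; lra.
have e4 m : 0 <= e m - 1 / 4 <= harmonic m.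
  rewrite /e; have [_ [h1 h2]] := rP m.+2; rewrite subr_ge0 h1 /=.
  rewrite -[leRHS]mul1r ler_pdivlMr // mulrC; apply: le_trans h2.
  by rewrite ler_wpM2r ?subr_ge0 // ler_nat.
have t1E m : t1 m = Num.sqrt (1 - e m).
  have [h _] := rP m.+2; rewrite -h tree_seriesS -/(e m) addrC addKr sqrtr_sqr ger0_norm //.
  by apply: le_trans (tree_series_ge _ _); exact: ltW.
have t2E m : t2 m = Num.sqrt (t1 m - e m).
  rewrite /t1 tree_seriesS addrC addKr sqrtr_sqr ger0_norm //.
  by apply: le_trans (tree_series_ge _ _); exact: ltW.
have cve : e m @[m --> \oo] --> (1 / 4 : R).
  have cve' : (e m - 1 / 4) @[m --> \oo] --> (0 : R).
    apply: (squeeze_cvgr _ (cvg_cst 0) cvg_harmonic).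
    by near=> m; exact: e4.
  rewrite -[1 / 4]add0r; apply: cvg_trans (cvgD cve' (cvg_cst (1 / 4 : R))).
  by apply: near_eq_cvg; near=> m; rewrite fctE /= subrK.
have cvt1 : t1 m @[m --> \oo] --> u1 R.
  under eq_fun do rewrite t1E; rewrite u1E.
  exact: (continuous_cvg _ (@sqrt_continuous R _) (cvgB (cvg_cst _) cve)).
have cvt2 : t2 m @[m --> \oo] --> u2 R.
  under eq_fun do rewrite t2E; rewrite u2E.
  exact: (continuous_cvg _ (@sqrt_continuous R _) (cvgB cvt1 cve)).
have dens_at m := dens_cvg_type_density conv U0 (e0 m) (rP m.+2).1.
have cvD : density_at R conv U k @[k --> \oo] --> type_density U (pcat R) (kappa R).
  rewrite -(cvg_shiftn 2).
  have V0 : vertex_sum U (pcat R) != 0.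
    by rewrite gt_eqF // vertex_sum_gt0 //; exact: pcat_gt0.
  have cvp c : all_masses (e m) (t1 m) c @[m --> \oo] --> pcat R c.
    rewrite pcatE; case: c => //=; apply: cvgB => //; exact: cvg_cst.
  have cvs c (t : nat -> R) l : t m @[m --> \oo] --> l ->
      short_masses (e m) (t m) c @[m --> \oo] --> short_masses (1 / 4) l c.
    by case: c => //= ct; [exact: cvgB|exact: cvg_cst].
  have cvq t i j : split_masses (e m) (t1 m) (t2 m) t i j @[m --> \oo] --> kappa R t i j.
    rewrite kappaE; case: t => /=; first exact: cvg_cst.
      by apply: cvgM; exact: cvs.
    by apply: cvgB; apply: cvgM; exact: cvs.
  apply: cvg_trans (type_density_cvg cvp cvq V0); apply: near_eq_cvg.
  near=> m; rewrite /= addn2 /density_at; apply/esym.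
  by apply/cvg_lim => //; exact: dens_at.
split; last by apply/cvg_lim => //; exact: cvD.
split; last exact: cvgP cvD.
by case=> [|[|k]] // _; apply: cvgP (dens_at k).
Unshelve. all: by end_near.
Qed.
End LimitWeights.

(** * Fractional orientations and duality *)

Local Close Scope classical_set_scope.

Definition inside (V : finType) (R : realType) (es : seq (V * V)) (c : V * V -> R)
    (U : {set V}) : R :=
  \sum_(e <- es | (e.1 \in U) && (e.2 \in U)) c e.

Lemma inside_supermodular (V : finType) (R : realType) (es : seq (V * V))
    (c : V * V -> R) (U W : {set V}) :
  {in es, forall e, 0 <= c e} ->
  inside es c U + inside es c W <= inside es c (U :|: W) + inside es c (U :&: W).
Proof.
move=> c0; rewrite /inside !(big_mkcond (fun e => (e.1 \in _) && _)) -!big_split /=.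
rewrite big_seq [leRHS]big_seq; apply: ler_sum => e /c0 ce.
rewrite !inE.
by case: (e.1 \in U); case: (e.2 \in U); case: (e.1 \in W); case: (e.2 \in W) => /=;
  rewrite ?addr0 ?add0r ?lerDl ?lerDr //.
Qed.

(** Each edge e has an amount c e to be shared between its ends, and cap bounds
    what a vertex receives in total. The condition is clearly necessary; it is
    sufficient by induction on the edges. The first end of e gets the largest
    share x that the slack of the sets containing it but not the other end
    allows. The sets W containing only the second end then have room for
    c e - x, because slack is submodular and a set containing both ends has
    slack at least c e. The predicate P records that the shares lie in any
    additive group that contains the data. *)
Lemma fractional_orientation (V : finType) (R : realType) (P : R -> Prop)
    (P0 : P 0) (PB : forall x y, P x -> P y -> P (x - y))
    (es : seq (V * V)) (c : V * V -> R) (cap : V -> R) :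
  uniq es -> {in es, forall e, [/\ e.1 != e.2, 0 <= c e & P (c e)]} ->
  (forall u, P (cap u)) ->
  (forall U : {set V}, inside es c U <= \sum_(u in U) cap u) ->
  exists A : V * V -> R,
    {in es, forall e, 0 <= A e <= c e /\ P (A e)} /\
    forall u, \sum_(e <- es | e.1 == u) A e
              + \sum_(e <- es | e.2 == u) (c e - A e) <= cap u.
Proof.
have PD x y : P x -> P y -> P (x + y).
  move=> Px Py; rewrite -[y]opprK; apply: (PB) => //.
  by rewrite -sub0r; apply: (PB).
have Psum (I : Type) (s : seq I) (Q : pred I) (F : I -> R) :
    (forall i, Q i -> P (F i)) -> P (\sum_(i <- s | Q i) F i).
  by move=> H; apply: big_ind => //.
elim: es cap => [|e es IH] cap /=.
  move=> _ _ _ H; exists (fun=> 0); split=> // u.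
  have := H [set u]; rewrite /inside !big_nil addr0 big_set1 //.
move=> /andP[e_es ues] Hes Pcap Hall.
have Hes' : {in es, forall f, [/\ f.1 != f.2, 0 <= c f & P (c f)]}.
  by move=> f fes; apply: Hes; rewrite inE fes orbT.
have [/= ne ce Pce] := Hes e (mem_head _ _).
have c0 : {in es, forall f, 0 <= c f} by move=> f /Hes'[].
pose slack (U : {set V}) := \sum_(u in U) cap u - inside es c U.
have Pslack U : P (slack U).
  apply: (PB); first by apply: (Psum).
  rewrite /inside big_seq_cond; apply: (Psum) => f /andP[/Hes' [//]].
have slackge (U : {set V}) : (if (e.1 \in U) && (e.2 \in U) then c e else 0) <= slack U.
  rewrite /slack lerBrDr; apply: le_trans (Hall U).
  by rewrite /inside big_cons; case: ifP => _; rewrite ?add0r.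
have slack_sub U W : slack (U :|: W) + slack (U :&: W) <= slack U + slack W.
  have := inside_supermodular U W c0.
  have : \sum_(u in U :|: W) cap u + \sum_(u in U :&: W) cap u =
      \sum_(u in U) cap u + \sum_(u in W) cap u.
    rewrite !(big_mkcond (fun u => u \in _)) -!big_split /=; apply: eq_bigr => u _.
    by rewrite !inE; case: (u \in U); case: (u \in W); rewrite /= ?addr0 ?add0r.
  rewrite /slack; lra.
have [x [x0 xc Px xU Ux]] : exists x, [/\ 0 <= x, x <= c e, P x,
    forall U : {set V}, e.1 \in U -> e.2 \notin U -> x <= slack U
  & forall W : {set V}, e.2 \in W -> e.1 \notin W -> c e - x <= slack W].
  (* The share is min (c e) (slack U0), for U0 of least slack among the sets
     that contain e.1 but not e.2. *)
  pose ok := [pred U : {set V} | (e.1 \in U) && (e.2 \notin U)].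
  have ok1 : ok [set e.1] by rewrite /= !inE eqxx eq_sym.
  case: (arg_minP slack ok1) => U0 /andP[U1 U2] minU.
  have sl0 : 0 <= slack U0 by have := slackge U0; rewrite (negbTE U2) andbF.
  exists (Num.min (c e) (slack U0)); split.
  - by rewrite le_min ce.
  - by rewrite ge_min lexx.
  - by rewrite /Num.min; case: ifP.
  - by move=> U ? ?; rewrite ge_min minU ?orbT //; apply/andP.
  move=> W W2 W1; have := slackge W; rewrite (negbTE W1) /= => slW.
  case: (leP (c e) (slack U0)) => _; first by rewrite subrr.
  have := slack_sub U0 W; have := slackge (U0 :|: W).
  rewrite !inE U1 W2 orbT /=.
  have := slackge (U0 :&: W); rewrite !inE (negbTE U2) andbF; lra.
pose cap' u := cap u - (if u == e.1 then x else 0) - (if u == e.2 then c e - x else 0).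
have sumcap' (U : {set V}) : \sum_(u in U) cap' u = \sum_(u in U) cap u
    - (if e.1 \in U then x else 0) - (if e.2 \in U then c e - x else 0).
  have sumone v y : \sum_(u in U) (if u == v then y else 0) = if v \in U then y else 0 :> R.
    rewrite -big_mkcondr /=; case: ifPn => vU.
      by rewrite (big_pred1 v) // => u; rewrite andbC /=; case: eqP => // ->.
    by rewrite big_pred0 // => u; case: eqP => [->|]; rewrite ?(negbTE vU) ?andbF.
  by rewrite /cap' !sumrB !sumone.
have [|U|A [HA Hcap]] := IH cap' ues Hes'.
- move=> u; rewrite /cap'; apply: (PB); first apply: (PB) => //.
  + by case: ifP.
  + by case: ifP => // _; apply: (PB).
- rewrite sumcap' -subr_ge0.
  have := slackge U; have := xU U; have := Ux U; rewrite /slack.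
  case: (e.1 \in U); case: (e.2 \in U) => //= h1 h2 h3.
  + by move: h3; lra.
  + by have := h2 isT isT; lra.
  + by have := h1 isT isT; lra.
  + by move: h3; lra.
exists (fun f => if f == e then x else A f); split.
  move=> f; rewrite inE; case: eqP => [-> _|_ /= /HA //].
  by rewrite x0 xc.
move=> u; rewrite !big_cons eqxx.
have -> : \sum_(f <- es | f.1 == u) (if f == e then x else A f) =
          \sum_(f <- es | f.1 == u) A f.
  rewrite big_seq_cond [RHS]big_seq_cond; apply: eq_bigr => f /andP[fes _].
  by case: eqP => // fe; rewrite -fe fes in e_es.
have -> : \sum_(f <- es | f.2 == u) (c f - (if f == e then x else A f)) =
          \sum_(f <- es | f.2 == u) (c f - A f).
  rewrite big_seq_cond [RHS]big_seq_cond; apply: eq_bigr => f /andP[fes _].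
  by case: eqP => // fe; rewrite -fe fes in e_es.
have := Hcap u; rewrite /cap' ![_ == u]eq_sym.
by case: ifP; case: ifP; lra.
Qed.

Section Certificates.
Variables (V : finType) (R : realType) (le : rel V).
Hypothesis le_total : total_order le.
Variables (m : V -> V -> R) (mu : V -> R).
Hypothesis m_ge0 : forall u v, 0 <= m u v.
Hypothesis mu_gt0 : forall u, 0 < mu u.

Let load (U : {set V}) : R := 2 * \sum_(u in U) \sum_(v in U | le u v) m u v.

Definition allocation (d : R) (A : V -> V -> R) : Prop :=
  (forall u v, strict le u v -> 0 <= A u v <= 2 * m u v) /\
  (forall u, 2 * m u u + \sum_(v | strict le u v) A u v
     + \sum_(v | strict le v u) (2 * m v u - A v u) <= d * mu u).

Lemma load_diag (U : {set V}) :
  load U = \sum_(u in U) 2 * m u u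
           + \sum_(u in U) \sum_(v in U | strict le u v) 2 * m u v.
Proof.
have [refl _ _ _] := le_total.
rewrite /load mulr_sumr -big_split /=; apply: eq_bigr => u uU.
rewrite (bigD1 u) /=; last by rewrite uU refl.
rewrite mulrDr mulr_sumr; congr (_ + _); apply: eq_bigl => v.
by rewrite /strict eq_sym -!andbA; congr (_ && _); rewrite andbC.
Qed.

Lemma allocation_exists (P : R -> Prop) (d : R) :
  P 0 -> (forall x y, P x -> P y -> P (x - y)) ->
  (forall u v, P (2 * m u v)) -> (forall u, P (d * mu u)) ->
  (forall U : {set V}, U != finset.set0 -> load U <= d * \sum_(u in U) mu u) ->
  exists A, allocation d A /\ (forall u v, strict le u v -> P (A u v)).
Proof.
move=> P0 PB Pm Pmu Hd.
pose es := [seq e <- enum {: V * V} | strict le e.1 e.2].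
have es_sum (Q : pred (V * V)) (F : V * V -> R) :
    \sum_(e <- es | Q e) F e = \sum_(e | strict le e.1 e.2 && Q e) F e.
  by rewrite big_filter_cond big_enum_cond.
have mem_es u v : ((u, v) \in es) = strict le u v.
  by rewrite mem_filter mem_enum andbT.
pose c (e : V * V) := 2 * m e.1 e.2.
pose cap u := d * mu u - 2 * m u u.
have [||u|U|A [HA Hcap]] := @fractional_orientation V R P P0 PB es c cap.
- by rewrite filter_uniq // enum_uniq.
- case=> u v; rewrite mem_es => /andP[uv _]; split=> //; last exact: Pm.
  by rewrite mulr_ge0.
- by rewrite /cap; apply: (PB).
- have [->|U0] := eqVneq U finset.set0.
    by rewrite /inside big1 ?big_set0 // => e; rewrite inE.
  have := Hd U U0; rewrite load_diag mulr_sumr /cap sumrB.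
  rewrite /inside es_sum.
  suff -> : \sum_(u in U) \sum_(v in U | strict le u v) 2 * m u v =
      \sum_(e | strict le e.1 e.2 && ((e.1 \in U) && (e.2 \in U))) c e by lra.
  rewrite pair_big_dep /=; apply: eq_bigl => e.
  by case: (e.1 \in U); case: (e.2 \in U) => /=; rewrite ?andbT ?andbF.
exists (fun u v => A (u, v)); split; last first.
  by move=> u v; rewrite -mem_es => /HA[].
split=> [u v|u]; first by rewrite -mem_es => /HA[].
have := Hcap u; rewrite /cap !es_sum.
have -> : \sum_(e | strict le e.1 e.2 && (e.1 == u)) A e =
          \sum_(v | strict le u v) A (u, v).
  transitivity (\sum_(w | w == u) \sum_(v | strict le w v) A (w, v)); last first.
    by rewrite big_pred1_eq.
  rewrite pair_big_dep /=; apply: eq_big => [e|[]//].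
  by rewrite andbC; case: eqP => //= ->.
have -> : \sum_(e | strict le e.1 e.2 && (e.2 == u)) (c e - A e) =
          \sum_(v | strict le v u) (2 * m v u - A (v, u)).
  transitivity (\sum_v \sum_(w | strict le v w && (w == u)) (2 * m v w - A (v, w))).
    by rewrite pair_big_dep /=; apply: eq_big => [e|[]//].
  rewrite (exchange_big_dep (pred1 u)) /=; last by move=> v w _ /andP[].
  rewrite big_pred1_eq; apply: eq_bigl => v; first by rewrite eqxx andbT.
lra.
Qed.

Lemma exchange_strict (F : V -> V -> R) :
  \sum_u \sum_(v | strict le u v) F u v = \sum_u \sum_(v | strict le v u) F v u.
Proof. by rewrite (exchange_big_dep predT). Qed.

(** Bounding z_uv by x_u on the part A_uv of the weight of an edge and by x_v
    on the rest turns the objective into a combination of the x_u whose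
    coefficients are the loads. *)
Lemma allocation_weak_duality d A (x : V -> R) (z : V -> V -> R) :
  allocation d A ->
  (forall u v, strict le u v -> [/\ 0 <= z u v, z u v <= x u & z u v <= x v]) ->
  (forall u, 0 <= x u) ->
  2 * (\sum_u \sum_(v | strict le u v) m u v * z u v) + 2 * \sum_u m u u * x u
    <= d * \sum_u mu u * x u.
Proof.
move=> [HA Hd] Hz x0.
have le1 : 2 * (\sum_u \sum_(v | strict le u v) m u v * z u v) <=
    \sum_u \sum_(v | strict le u v) (A u v * x u + (2 * m u v - A u v) * x v).
  rewrite mulr_sumr; apply: ler_sum => u _; rewrite mulr_sumr; apply: ler_sum => v uv.
  have /andP[A0 A1] := HA u v uv; have [z0 zu zv] := Hz u v uv.
  have := ler_wpM2l A0 zu.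
  have : 0 <= 2 * m u v - A u v by lra.
  by move=> /ler_wpM2l /(_ _ _ zv); lra.
apply: le_trans (_ : \sum_u (2 * m u u + \sum_(v | strict le u v) A u v
     + \sum_(v | strict le v u) (2 * m v u - A v u)) * x u <= _); last first.
  rewrite mulr_sumr; apply: ler_sum => u _.
  by rewrite mulrA ler_wpM2r.
apply: le_trans (lerD le1 (lexx _)) _.
have -> : \sum_u \sum_(v | strict le u v) (A u v * x u + (2 * m u v - A u v) * x v)
   = \sum_u (\sum_(v | strict le u v) A u v) * x u
     + \sum_u (\sum_(v | strict le v u) (2 * m v u - A v u)) * x u.
  under eq_bigr do rewrite big_split /=.
  rewrite big_split /= [X in _ + X]exchange_strict.
  by congr (_ + _); apply: eq_bigr => u _; rewrite mulr_suml.
rewrite mulr_sumr -!big_split /=.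
by apply: ler_sum => u _; rewrite !mulrDl; lra.
Qed.

Definition set_point (U : {set V}) (u : V) : R := (u \in U)%:R / \sum_(u in U) mu u.
Definition set_pair_point (U : {set V}) (u v : V) : R :=
  ((u \in U) && (v \in U))%:R / \sum_(u in U) mu u.

Lemma measure_gt0 (U : {set V}) : U != finset.set0 -> 0 < \sum_(u in U) mu u.
Proof.
case/set0Pn=> u uU; rewrite (bigD1 u) //= ltr_pwDl // sumr_ge0 // => v _.
exact: ltW.
Qed.

Lemma set_point_feasible (U : {set V}) : U != finset.set0 ->
  [/\ forall u v, strict le u v ->
        [/\ 0 <= set_pair_point U u v, set_pair_point U u v <= set_point U u &
            set_pair_point U u v <= set_point U v],
      forall u, 0 <= set_point U u
    & \sum_u mu u * set_point U u = 1].
Proof.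
move=> /measure_gt0 M0; split.
- move=> u v _; rewrite /set_point /set_pair_point; split.
  + by rewrite divr_ge0 ?ler0n // ltW.
  + by rewrite ler_pM2r ?invr_gt0 // ler_nat; case: (u \in U); case: (v \in U).
  + by rewrite ler_pM2r ?invr_gt0 // ler_nat; case: (u \in U); case: (v \in U).
- by move=> u; rewrite divr_ge0 ?ler0n // ltW.
rewrite /set_point; under eq_bigr do rewrite mulrA.
rewrite -mulr_suml -[X in X / _](_ : \sum_(u in U) mu u = _) ?divff ?gt_eqF //.
rewrite big_mkcond; apply: eq_bigr => u _.
by case: (u \in U); rewrite ?mulr1 ?mulr0.
Qed.

Lemma set_point_objective (U : {set V}) :
  2 * (\sum_u \sum_(v | strict le u v) m u v * set_pair_point U u v)
    + 2 * \sum_u m u u * set_point U u = load U / \sum_(u in U) mu u.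
Proof.
rewrite load_diag [RHS]mulrDl addrC; congr (_ + _).
  rewrite mulr_sumr mulr_suml [RHS]big_mkcond; apply: eq_bigr => u _.
  by rewrite /set_point; case: (u \in U); rewrite ?mul0r ?mulr0 // mul1r mulrA.
rewrite mulr_sumr mulr_suml [RHS]big_mkcond; apply: eq_bigr => u _.
rewrite mulr_sumr /set_pair_point; case: (u \in U) => /=; last first.
  by rewrite big1 // => v _; rewrite mul0r !mulr0.
rewrite mulr_suml big_mkcond [RHS]big_mkcond; apply: eq_bigr => v _.
by case: (v \in U) => /=; case: (strict _ _ _); rewrite ?mul0r ?mulr0 // mul1r mulrA.
Qed.

Lemma load_le (U : {set V}) d : U != finset.set0 ->
  (load U / \sum_(u in U) mu u <= d) = (load U <= d * \sum_(u in U) mu u).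
Proof. by move=> /measure_gt0 M0; rewrite ler_pdivrMr. Qed.

(** This is weak duality at the point 1_U / mu(U), where the objective is the
    density of U. *)
Lemma allocation_sound d A (U : {set V}) : allocation d A -> U != finset.set0 ->
  load U / \sum_(u in U) mu u <= d.
Proof.
move=> HA /set_point_feasible[F1 F2 F3].
by have := allocation_weak_duality HA F1 F2; rewrite F3 set_point_objective mulr1.
Qed.

Lemma allocation_complete (P : R -> Prop) d :
  P 0 -> (forall x y, P x -> P y -> P (x - y)) ->
  (forall u v, P (2 * m u v)) -> (forall u, P (d * mu u)) ->
  (forall U : {set V}, U != finset.set0 -> load U / \sum_(u in U) mu u <= d) ->
  exists A, allocation d A /\ (forall u v, strict le u v -> P (A u v)).
Proof.
move=> P0 PB Pm Pmu H; apply: allocation_exists => // U U0.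
by rewrite -load_le // H.
Qed.

End Certificates.

(** * Weights of unordered pairs, the field K, and the theorem *)

Section PairSums.
Variables (R : realType) (w : nat) (le : rel (word w)).
Hypothesis le_total : total_order le.

(** A total order lists each unordered pair of types exactly once. *)
Lemma sum_same_pair (U : {set word w}) (x y : seq category) (c : R) :
  size x = w -> size y = w ->
  \sum_(u in U) \sum_(v in U | le u v) (if same_pair x y u v then c else 0) =
  if has_type U x && has_type U y then c else 0.
Proof.
move=> /eqP sx /eqP sy.
pose X : word w := Tuple sx; pose Y : word w := Tuple sy.
rewrite -[x]/(tval X) -[y]/(tval Y) !has_type_val.
move: X Y => {x y sx sy} X Y.
have [refl anti _ tot] := le_total.
wlog XY : X Y / le X Y.
  move=> H; case/orP: (tot X Y) => XY; first exact: H.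
  rewrite andbC -(H Y X XY); apply: eq_bigr => u _; apply: eq_bigr => v _.
  by rewrite /same_pair orbC [(tval Y == _) && _]andbC [(tval Y == tval v) && _]andbC.
have pairE u v : le u v -> same_pair X Y u v = (X == u) && (Y == v).
  move=> uv; rewrite /same_pair !val_eqE; apply/orb_idr => /andP[/eqP Xv /eqP Yu].
  by move: uv; rewrite -Xv -Yu => YX; rewrite (anti X Y) ?eqxx // XY YX.
rewrite (eq_bigr (fun u => if X == u then \sum_(v in U | le X v) (if Y == v then c else 0)
    else 0)); last first.
  move=> u uU; case: eqP => [<-|Xu].
    by apply: eq_bigr => v /andP[_ Xv]; rewrite pairE // eqxx.
  by rewrite big1 // => v /andP[_ uv]; rewrite pairE //; case: eqP.
rewrite -big_mkcondr /=; case: ifPn => [/andP[XU YU]|].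
  rewrite (big_pred1 X) => [|u]; last by rewrite /= andbC eq_sym; case: eqP => // ->.
  rewrite -big_mkcondr (big_pred1 Y) // => v.
  by rewrite /= andbC eq_sym; case: eqP => // ->; rewrite YU.
rewrite negb_and => XYU; rewrite big1 // => u /andP[uU /eqP Xu]; subst u.
rewrite big1 // => v /andP[vU _]; case: eqP => // Yv; subst v.
by move: XYU; rewrite uU vU.
Qed.
End PairSums.

Section DensityFormula.
Variables (R : realType) (a b : nat) (le : rel (word (width a b))).
Hypothesis le_total : total_order le.

Lemma type_densityE (U : {set word (width a b)}) :
  type_density U (pcat R) (kappa R) = density_formula R le U.
Proof.
rewrite /type_density /density_formula; congr (2 * _ / _).
pose Q (e : word (width a b) * word (width a b)) :=
  [&& e.1 \in U, e.2 \in U & le e.1 e.2].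
have swap (F : word (width a b) -> word (width a b) -> R) :
    \sum_(u in U) \sum_(v in U | le u v) F u v = \sum_(e | Q e) F e.1 e.2.
  by rewrite pair_big_dep; apply: eq_bigl => e.
rewrite swap /mweight big_split /=; congr (_ + _).
  under [RHS]eq_bigr do rewrite big_mkcond.
  rewrite [RHS]exchange_big /= /horizontal_sum big_mkcond; apply: eq_bigr => z _.
  rewrite -(swap (fun u v => if same_pair (take (width a b) z) (drop 1 z) u v then wt R z else 0)).
  by rewrite sum_same_pair // ?size_take ?size_drop ?size_tuple ?ltnS ?leqnn ?subn1.
rewrite [RHS]exchange_big; apply: eq_bigr => A _.
rewrite [RHS]exchange_big; apply: eq_bigr => B _.
rewrite [RHS]exchange_big; apply: eq_bigr => t _.
rewrite [RHS]exchange_big; apply: eq_bigr => i _.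
under [RHS]eq_bigr do rewrite big_mkcond.
rewrite [RHS]exchange_big /= big_mkcond; apply: eq_bigr => j _.
rewrite -(swap (fun u v => if same_pair (A ++ t :: B) (A ++ take b.+1 [:: i, j & B]) u v
   then wt R (A ++ B) * kappa R t i j else 0)).
by rewrite sum_same_pair // ?size_cat /= ?size_takel /= ?size_tuple ?addnS ?ltnS //.
Qed.

End DensityFormula.

Section FieldK.
Variable R : realType.
Implicit Types x y : R.

Lemma in_K_sub x y : in_K x -> in_K y -> in_K (x - y).
Proof. by move=> hx hy S SS h1 h2; case: (SS) => _ B _; apply: B; [exact: hx|exact: hy]. Qed.

Lemma in_K_div x y : in_K x -> in_K y -> in_K (x / y).
Proof. by move=> hx hy S SS h1 h2; case: (SS) => _ _; apply; [exact: hx|exact: hy]. Qed.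

Lemma in_K1 : in_K (1 : R).
Proof. by move=> S []. Qed.

Lemma in_K0 : in_K (0 : R).
Proof. by rewrite -(subrr 1); apply: in_K_sub; exact: in_K1. Qed.

Lemma in_K_add x y : in_K x -> in_K y -> in_K (x + y).
Proof.
move=> hx hy; rewrite -[y]opprK; apply: in_K_sub => //.
by rewrite -sub0r; apply: in_K_sub => //; exact: in_K0.
Qed.

Lemma in_K_mul x y : in_K x -> in_K y -> in_K (x * y).
Proof.
move=> hx hy; rewrite -[y]invrK; apply: in_K_div => //.
by rewrite -div1r; apply: in_K_div => //; exact: in_K1.
Qed.

Lemma in_K_nat n : in_K (n%:R : R).
Proof.
elim: n => [|n IH]; first exact: in_K0.
by rewrite -natr1; apply: in_K_add => //; exact: in_K1.
Qed.

Lemma in_K_sum (I : Type) (s : seq I) (P : pred I) (F : I -> R) :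
  (forall i, P i -> in_K (F i)) -> in_K (\sum_(i <- s | P i) F i).
Proof. by move=> h; apply: big_ind => //; [exact: in_K0|exact: in_K_add]. Qed.

Lemma in_K_prod (I : Type) (s : seq I) (P : pred I) (F : I -> R) :
  (forall i, P i -> in_K (F i)) -> in_K (\prod_(i <- s | P i) F i).
Proof. by move=> h; apply: big_ind => //; [exact: in_K1|exact: in_K_mul]. Qed.

Lemma in_K_sqrt3 : in_K (Num.sqrt 3 : R). Proof. by move=> S. Qed.
Lemma in_K_sqrt_sqrt3 : in_K (Num.sqrt (2 * Num.sqrt 3 - 1) : R). Proof. by move=> S. Qed.

Lemma in_K_quarter : in_K (1 / 4 : R).
Proof. by apply: in_K_div; [exact: in_K1|exact: in_K_nat]. Qed.

Lemma in_K_pcat c : in_K (pcat R c).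
Proof.
have h3 : in_K (Num.sqrt 3 / 2 : R).
  by apply: in_K_div; [exact: in_K_sqrt3|exact: in_K_nat].
by case: c => /=; [exact: in_K_quarter|apply: in_K_sub => //; exact: in_K_quarter|
  apply: in_K_sub => //; exact: in_K1].
Qed.

Lemma in_K_wt s : in_K (wt R s).
Proof. by apply: in_K_prod => c _; exact: in_K_pcat. Qed.

Lemma in_K_v1 c : in_K (v1 R c).
Proof.
case: c => /=; [exact: in_K_quarter| |exact: in_K0].
apply: in_K_sub; last exact: in_K_quarter.
by apply: in_K_div; [exact: in_K_sqrt3|exact: in_K_nat].
Qed.

Lemma in_K_v2 c : in_K (v2 R c).
Proof.
case: c => /=; [exact: in_K_quarter| |exact: in_K0].
apply: in_K_sub; last exact: in_K_quarter.
by apply: in_K_div; [exact: in_K_sqrt_sqrt3|exact: in_K_nat].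
Qed.

Lemma in_K_kappa t i j : in_K (kappa R t i j).
Proof.
case: t => /=; first exact: in_K0.
  by apply: in_K_mul; exact: in_K_v2.
by apply: in_K_sub; apply: in_K_mul; (exact: in_K_v1 || exact: in_K_v2).
Qed.

Lemma in_K_mweight a b (u v : word (width a b)) : in_K (mweight R u v).
Proof.
apply: in_K_add; first by apply: in_K_sum => z _; exact: in_K_wt.
do 5 (apply: in_K_sum => ? _).
by apply: in_K_mul; [exact: in_K_wt|exact: in_K_kappa].
Qed.

Lemma in_K_mu w (u : word w) : in_K (mu R u).
Proof. exact: in_K_wt. Qed.

End FieldK.

Section Positivity.
Variable R : realType.

Lemma wt_gt0 s : 0 < wt R s.
Proof. by apply: prodr_gt0 => c _; exact: pcat_gt0. Qed.

Lemma kappa_ge0 t i j : 0 <= kappa R t i j.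
Proof.
have h3 := sqrt3_sq R; have h0 := sqrt3_ge0 R.
have g2 : 1 / 4 <= u2 R.
  rewrite u2E -[X in X <= _]ger0_norm -?sqrtr_sqr ?ler_wsqrtr /u1 //; nra.
have g1 : u2 R <= u1 R.
  rewrite /u1 /u2 ler_pM2r ?invr_gt0 // ler_wsqrtr //; nra.
have s2 c : 0 <= v2 R c by case: c => //=; lra.
have s12 c : v2 R c <= v1 R c by case: c => //=; lra.
case: t => //=; first by rewrite mulr_ge0.
by rewrite subr_ge0 ler_pM.
Qed.

Lemma mweight_ge0 a b (u v : word (width a b)) : 0 <= mweight R u v.
Proof.
apply: addr_ge0; first by apply: sumr_ge0 => z _; exact: ltW (wt_gt0 _).
do 5 (apply: sumr_ge0 => ? _).
by rewrite mulr_ge0 ?kappa_ge0 // ltW // wt_gt0.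
Qed.
End Positivity.

Theorem theorem6p1 (R : realType) (a b : nat) (conv : convention a b)
    (le : rel (word (width a b))) (le_total : total_order le) :
  (forall U : {set word (width a b)}, U != finset.set0 ->
     D_exists R conv U /\ D R conv U = density_formula R le U)
  /\
  (forall u v : word (width a b), le u v -> in_K (mweight R u v))
  /\
  (forall u : word (width a b), in_K (mu R u))
  /\
  (forall d : R,
     (forall U : {set word (width a b)}, U != finset.set0 -> D R conv U <= d) <->
     (exists A : word (width a b) -> word (width a b) -> R,
        certificate le d A))
  /\
  (exists opt : R,
     [/\ max_density conv opt,
         lp_optimum le opt,
         in_K opt
       & exists A : word (width a b) -> word (width a b) -> R,
           certificate le opt A /\
           (forall u v, strict le u v -> in_K (A u v))]).
Proof.
have DE U : U != finset.set0 -> D_exists R conv U /\ D R conv U = density_formula R le U.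
  by move=> /(D_type_density R conv)[e ->]; rewrite (type_densityE R le_total).
have m0 := @mweight_ge0 R a b.
have mu0 (u : word (width a b)) : 0 < mu R u by exact: wt_gt0.
have DK (U : {set word (width a b)}) : in_K (density_formula R le U).
  apply: in_K_div; last by apply: in_K_sum => u _; exact: in_K_mu.
  apply: in_K_mul; first exact: in_K_nat.
  by do 2 (apply: in_K_sum => ? _); exact: in_K_mweight.
split=> //; split; first by move=> u v _; exact: in_K_mweight.
split; first exact: in_K_mu.
have complete (P : R -> Prop) d := allocation_complete le_total m0 mu0 (P := P) (d := d).
split=> [d|].
  split=> [H|[A HA] U U0].
    have [||||U U0|A [HA _]] := complete (fun=> True) d => //; last by exists A.
    by have := H U U0; rewrite (DE U U0).2.
  by rewrite (DE U U0).2; apply: (allocation_sound le_total mu0 HA U0).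
pose w0 : word (width a b) := nseq_tuple _ catE.
have U10 : [set w0] != finset.set0 by apply/set0Pn; exists w0; rewrite set11.
case: (@arg_maxP _ _ _ [set w0] (fun U => U != finset.set0)
  (fun U => density_formula R le U) U10) => U U0 maxU.
set opt := density_formula R le U in maxU.
have [|||u|V V0|A [HA AK]] := complete (@in_K R) opt.
- exact: in_K0.
- exact: in_K_sub.
- by move=> u v; apply: in_K_mul; [exact: in_K_nat|exact: in_K_mweight].
- by apply: in_K_mul; [exact: DK|exact: in_K_mu].
- exact: maxU.
exists opt; split; [| |exact: DK|by exists A].
- split; first by exists U => //; rewrite (DE U U0).2.
  by move=> V V0; rewrite (DE V V0).2; exact: maxU.
split.
  exists (set_point (mu R (w := width a b)) U), (set_pair_point (mu R (w := width a b)) U).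
  split; first exact: (set_point_feasible le mu0 U0).
  exact: (set_point_objective le_total).
move=> x z [F1 F2 F3].
have := allocation_weak_duality HA F1 F2.
by rewrite F3 mulr1.
Qed.
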